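(* Let $M$ be an $n$-dimensional submanifold of $\mathbb{R}^{n+m}$ which is a graph (i.e. $M$ is the graph of a smooth map defined on all of $\mathbb{R}^n$) and which is a self-shrinker, i.e. its mean curvature vector satisfies $H=-\frac{1}{2}\vec{x}^{N}$, where $\vec{x}$ is the position vector and $\vec{x}^N$ its component in the normal bundle $NM$. Suppose moreover that $M$ has flat normal bundle. Then $M$ is a linear subspace of $\mathbb{R}^{n+m}$.
   Context: The normal bundle $NM$ is flat if the curvature of the normal connection vanishes identically. ''Graphic'' is taken, as in the paper's proof, to mean an entire graph over an $n$-dimensional linear subspace, so that $M$ is properly embedded. *)

(* Defs.v *)
From HB Require Import structures.
From mathcomp Require Import all_boot all_order all_algebra.
From mathcomp Require Import all_classical all_reals all_analysis.
Set Implicit Arguments. Unset Strict Implicit. Unset Printing Implicit Defensive.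
Import Order.TTheory GRing.Theory Num.Theory.
Import numFieldNormedType.Exports.
Local Open Scope ring_scope.

Section Graph.
Variable R : realType.

Definition evec (n : nat) (i : 'I_n) : 'rV[R]_n := delta_mx 0 i.

Definition pd (n k : nat) (i : 'I_n) (f : 'rV[R]_n -> 'rV[R]_k) : 'rV[R]_n -> 'rV[R]_k :=
  fun x => derive f x (evec i).

Fixpoint iter_pd (n k : nat) (l : seq 'I_n) (f : 'rV[R]_n -> 'rV[R]_k) :=
  match l with
  | [::] => f
  | i :: l' => pd i (iter_pd l' f)
  end.

Definition smooth (n k : nat) (f : 'rV[R]_n -> 'rV[R]_k) : Prop :=
  forall (l : seq 'I_n) (x : 'rV[R]_n), differentiable (iter_pd l f) x.

Definition dotv (N : nat) (a b : 'rV[R]_N) : R := (a *m b^T) 0 0.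

Definition graph_map (n m : nat) (u : 'rV[R]_n -> 'rV[R]_m) : 'rV[R]_n -> 'rV[R]_(n + m) :=
  fun x => row_mx x (u x).

Section Immersion.
Variables (n m : nat) (u : 'rV[R]_n -> 'rV[R]_m).
Let F := graph_map u.

Definition tangent (i : 'I_n) (x : 'rV[R]_n) : 'rV[R]_(n + m) := pd i F x.

Definition metric (x : 'rV[R]_n) : 'M[R]_n :=
  \matrix_(i, j) dotv (tangent i x) (tangent j x).
Definition metric_inv (x : 'rV[R]_n) : 'M[R]_n := invmx (metric x).

Definition tproj (x : 'rV[R]_n) (v : 'rV[R]_(n + m)) : 'rV[R]_(n + m) :=
  \sum_(i < n) \sum_(j < n) (metric_inv x i j * dotv v (tangent j x)) *: tangent i x.

Definition nproj (x : 'rV[R]_n) (v : 'rV[R]_(n + m)) : 'rV[R]_(n + m) :=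
  v - tproj x v.

(* mean curvature vector H = g^ij (d_i d_j F)^N  (trace of 2nd fundamental form) *)
Definition mean_curv (x : 'rV[R]_n) : 'rV[R]_(n + m) :=
  \sum_(i < n) \sum_(j < n) metric_inv x i j *: nproj x (pd i (pd j F) x).

Definition self_shrinker : Prop :=
  forall x, mean_curv x = - (2%:R)^-1 *: nproj x (F x).

Definition normal_field (nu : 'rV[R]_n -> 'rV[R]_(n + m)) : Prop :=
  smooth nu /\ forall x (i : 'I_n), dotv (nu x) (tangent i x) = 0.

Definition nabla_perp (i : 'I_n) (nu : 'rV[R]_n -> 'rV[R]_(n + m)) :
    'rV[R]_n -> 'rV[R]_(n + m) :=
  fun x => nproj x (pd i nu x).

(* flat normal bundle: the normal curvature
   R^perp(d_i, d_j) nu = nabla_i nabla_j nu - nabla_j nabla_i nu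
   (coordinate fields commute) vanishes identically *)
Definition flat_normal_bundle : Prop :=
  forall nu, normal_field nu ->
  forall (i j : 'I_n) x,
    nabla_perp i (nabla_perp j nu) x = nabla_perp j (nabla_perp i nu) x.

End Immersion.
End Graph.

(* Main.v *)
(** Let [D] be the [n x m] matrix of first derivatives of [u], [g = 1 + D D^T] the induced
metric, [S] its inverse, and [U_a] the Hessian of the [a]-th component of [u].  In the graph
coordinates the drift Laplacian of a self-shrinker is [L f = S_kl f_kl - 1/2 x_k f_k], and the
shrinker equation reads [L u = - u / 2].  By the Ricci equation, flatness of the normal bundle
means [U_a S U_b = U_b S U_a].  Differentiating the shrinker equation and using this commutation,
the function [w = (det g)^(-1/2) > 0] satisfies [L w = - |B|^2 w], where [B] is the second
fundamental form.  Since [g >= 1], one has [L |x|^2 <= 2 n - |x|^2]; comparing [w] with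
[w + e |x|^2] shows that the supersolution [w] attains its minimum, and the strong maximum
principle (Hopf's barrier) makes it constant.  Hence [B = 0], so [D] is constant, and then
the shrinker equation gives [u x = x D]. *)

Require Import Defs.
From HB Require Import structures.
From mathcomp Require Import all_boot all_order all_algebra.
From mathcomp Require Import all_classical all_reals all_analysis.
From mathcomp Require Import ring lra.
Import Order.TTheory GRing.Theory Num.Theory.
Import numFieldNormedType.Exports.
Local Open Scope ring_scope.
Local Open Scope classical_set_scope.
Set Implicit Arguments.
Unset Strict Implicit.
Unset Printing Implicit Defensive.

(** Christoffel symbols never appear: on a self-shrinker the intrinsic operator, the Laplacian of M
    minus half the derivative along the tangential position vector, sends the coordinate [x_k] to
    [- x_k / 2], so its first-order part in graph coordinates is exactly the drift. Everything can
    therefore be computed on flat space with a matrix field [S].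

    The weight [w] is the Jacobian of the projection of M onto its domain. Its exponent is forced by
    algebra. With [E = S D], both [L (ln det g)] and the squared gradient of [ln det g] contain a
    sum of entries of [E^T U_a S U_b E], but with [U_a] and [U_b] in opposite orders. Flatness
    identifies the two sums, and among nonzero powers of [det g] only [-1/2] makes them cancel,
    leaving [-|B|^2].

    M is not compact, so a minimum could escape to infinity; the inward drift prevents this because
    the trace of [S] is at most [n]. Positivity is obtained throughout from explicit Gram
    factorizations such as [S = S S^T + E E^T], which take the place of eigenvalues and
    diagonalization. *)

(* Locked: unfolding a directional derivative while comparing two terms is very costly. *)
HB.lock Definition dpart (R : realType) (n : nat) (i : 'I_n) (f : 'rV[R]_n -> R) :
  'rV[R]_n -> R := fun x => 'D_(evec R i) f x.

(** * Scalar calculus with coordinate partial derivatives *)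

Section Calculus.
Context {R : realType} {n : nat}.
Implicit Types (f g : 'rV[R]_n -> R) (i j : 'I_n) (x y p v : 'rV[R]_n).

Lemma dpartE i f x : dpart i f x = 'D_(evec R i) f x.
Proof. by rewrite dpart.unlock. Qed.

(** Level [k] asks that all partial derivatives of orders 0 to [k] be Fréchet differentiable, so
    [Cdiff 0] is already differentiability, and level [k] implies class C^k. *)
Fixpoint Cdiff (k : nat) f : Prop :=
  (forall x, differentiable f x) /\
  (if k is k'.+1 then forall i, Cdiff k' (dpart i f) else True).

Lemma Cdiff_differentiable k f x : Cdiff k f -> differentiable f x.
Proof. by case: k => [|k] [df _]; exact: df. Qed.

Lemma Cdiff_dpart k i f : Cdiff k.+1 f -> Cdiff k (dpart i f).
Proof. by move=> [_ Cf]; exact: Cf. Qed.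

Lemma CdiffW k f : Cdiff k.+1 f -> Cdiff k f.
Proof.
elim: k f => [|k IH] f [df pf]; first by split.
by split=> // i; apply/IH/pf.
Qed.

Lemma Cdiff_continuous k f : Cdiff k f -> continuous f.
Proof. by move=> cf x; apply/differentiable_continuous/(Cdiff_differentiable x cf). Qed.

Lemma dpart_cst i (c : R) : dpart i (fun=> c) = fun=> 0.
Proof. by apply/funext => x; rewrite dpartE; exact: derive_cst. Qed.

Lemma Cdiff_cst k (c : R) : Cdiff k (fun=> c).
Proof.
elim: k c => [|k IH] c; split=> //; try by move=> x; exact: differentiable_cst.
by move=> i; rewrite dpart_cst.
Qed.

Lemma dpart_coord i j : dpart i (fun x => x 0 j) = fun=> (i == j)%:R.
Proof.
apply/funext => x; have did : derivable (@id 'rV[R]_n) x (evec R i) by exact: derivable_id.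
have := derive_mx did; rewrite derive_id => /matrixP/(_ 0 j).
by rewrite dpartE /evec !mxE eqxx eq_sym /= => ->.
Qed.

Lemma Cdiff_coord k j : Cdiff k (fun x => x 0 j).
Proof.
case: k => [|k]; split=> //; try by move=> x; exact: differentiable_coord.
by move=> i; rewrite dpart_coord; exact: Cdiff_cst.
Qed.

Lemma dpartD i f g x : differentiable f x -> differentiable g x ->
  dpart i (fun y => f y + g y) x = dpart i f x + dpart i g x.
Proof. by move=> df dg; rewrite !dpartE; apply: deriveD; exact: diff_derivable. Qed.

Lemma dpartN i f x : differentiable f x ->
  dpart i (fun y => - f y) x = - dpart i f x.
Proof. by move=> df; rewrite !dpartE; apply: deriveN; exact: diff_derivable. Qed.

Lemma dpartM i f g x : differentiable f x -> differentiable g x ->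
  dpart i (fun y => f y * g y) x = f x * dpart i g x + g x * dpart i f x.
Proof. by move=> df dg; rewrite !dpartE; apply: deriveM; exact: diff_derivable. Qed.

Lemma dpartZ i c f x : differentiable f x ->
  dpart i (fun y => c * f y) x = c * dpart i f x.
Proof.
by move=> df; rewrite dpartM ?dpart_cst ?mulr0 ?addr0//; exact: differentiable_cst.
Qed.

Lemma dpart_comp (phi : R -> R) (dphi : R) i f x : differentiable f x ->
  is_derive (f x) 1 phi dphi -> dpart i (fun y => phi (f y)) x = dphi * dpart i f x.
Proof.
move=> df phid.
have dphif : differentiable phi (f x) by apply/derivable1_diffP; case: phid.
rewrite !dpartE (@deriveE _ _ _ (fun y => phi (f y))); last exact: differentiable_comp.
rewrite diff_comp//= (deriveE _ df).
set d := 'd f x _.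
(* The differential of [phi] is linear on the line, so its value at [d] is [d] times its value at
   1. *)
rewrite -[d in LHS]mulr1 -[d * 1]/(d *: (1 : R)) linearZ /= -deriveE//.
by case: phid => _ ->; rewrite mulrC.
Qed.

Lemma differentiable_comp1 (phi : R -> R) (dphi : R) f x : differentiable f x ->
  is_derive (f x) 1 phi dphi -> differentiable (fun y => phi (f y)) x.
Proof.
by move=> df phid; apply: differentiable_comp => //; apply/derivable1_diffP; case: phid.
Qed.

Lemma Cdiff_ext k f g : f =1 g -> Cdiff k f -> Cdiff k g.
Proof. by move=> /funext ->. Qed.

Lemma CdiffD k f g : Cdiff k f -> Cdiff k g -> Cdiff k (fun x => f x + g x).
Proof.
elim: k f g => [|k IH] f g [df pf] [dg pg]; split=> //;
  try by move=> x; apply: differentiableD.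
by move=> i; apply: (Cdiff_ext (fun x => esym (dpartD i (df x) (dg x))));
  apply: IH; [exact: pf|exact: pg].
Qed.

Lemma CdiffM k f g : Cdiff k f -> Cdiff k g -> Cdiff k (fun x => f x * g x).
Proof.
elim: k f g => [|k IH] f g Cf Cg; have [df pf] := Cf; have [dg pg] := Cg;
  split=> //;
  try by move=> x; apply: differentiableM.
move=> i; apply: (Cdiff_ext (fun x => esym (dpartM i (df x) (dg x)))).
by apply: CdiffD; apply: IH; by [exact: CdiffW|exact: pf|exact: pg].
Qed.

Lemma CdiffZ k c f : Cdiff k f -> Cdiff k (fun x => c * f x).
Proof. by move=> Cf; apply: CdiffM => //; exact: Cdiff_cst. Qed.

Lemma CdiffN k f : Cdiff k f -> Cdiff k (fun x => - f x).
Proof.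
by move=> /(@CdiffZ k (-1)); apply: Cdiff_ext => x; rewrite mulN1r.
Qed.

Lemma CdiffB k f g : Cdiff k f -> Cdiff k g -> Cdiff k (fun x => f x - g x).
Proof. by move=> Cf Cg; apply: CdiffD => //; exact: CdiffN. Qed.

Lemma Cdiff_sum k (I : Type) (r : seq I) (P : pred I) (F : I -> 'rV[R]_n -> R) :
  (forall a, Cdiff k (F a)) -> Cdiff k (fun x => \sum_(a <- r | P a) F a x).
Proof.
move=> CF; elim: r => [|a r IH].
  by apply: Cdiff_ext (Cdiff_cst k 0) => x; rewrite big_nil.
case Pa : (P a); last by apply: Cdiff_ext IH => x; rewrite big_cons Pa.
by apply: Cdiff_ext (CdiffD (CF a) IH) => x; rewrite big_cons Pa.
Qed.

Lemma Cdiff_prod k (I : Type) (r : seq I) (P : pred I) (F : I -> 'rV[R]_n -> R) :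
  (forall a, Cdiff k (F a)) -> Cdiff k (fun x => \prod_(a <- r | P a) F a x).
Proof.
move=> CF; elim: r => [|a r IH].
  by apply: Cdiff_ext (Cdiff_cst k 1) => x; rewrite big_nil.
case Pa : (P a); last by apply: Cdiff_ext IH => x; rewrite big_cons Pa.
by apply: Cdiff_ext (CdiffM (CF a) IH) => x; rewrite big_cons Pa.
Qed.

Lemma dpart_sum i (I : Type) (r : seq I) (P : pred I) (F : I -> 'rV[R]_n -> R) x :
  (forall a y, differentiable (F a) y) ->
  dpart i (fun y => \sum_(a <- r | P a) F a y) x = \sum_(a <- r | P a) dpart i (F a) x.
Proof.
move=> dF; elim: r => [|a r IH].
  rewrite big_nil; transitivity (dpart i (fun=> 0) x); last by rewrite dpart_cst.
  by congr (dpart i _ x); apply/funext => y; rewrite big_nil.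
rewrite big_cons -IH; case Pa : (P a); last first.
  by congr (dpart i _ x); apply/funext => y; rewrite big_cons Pa.
rewrite -dpartD//; first by congr (dpart i _ x); apply/funext => y; rewrite big_cons Pa.
exact: (Cdiff_differentiable _ (@Cdiff_sum 0 _ r P F (fun a => conj (dF a) Logic.I))).
Qed.

Lemma is_derive_inv (c : R) : c != 0 -> is_derive c 1 (@GRing.inv R) (- c ^- 2).
Proof.
move=> c0; have cid : derivable (@id R) c 1 by exact: derivable_id.
apply: DeriveDef; first exact: (@derivableV _ _ id).
by have := @deriveV _ _ id c 1 c0 cid; rewrite derive_id => ->; rewrite [LHS]mulr1.
Qed.

(** The derivative of [1/f] is [-(1/f)(1/f)] times that of [f]; the induction hypothesis covers
    [1/f] one level down. *)
Lemma CdiffV k f : (forall x, f x != 0) -> Cdiff k f -> Cdiff k (fun x => (f x)^-1).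
Proof.
move=> f0; elim: k f f0 => [|k IH] f f0 Cf; have [df pf] := Cf; split=> //;
  try by move=> x; apply: differentiableV.
move=> i; apply: (@Cdiff_ext _ (fun x => - ((f x)^-1 * (f x)^-1) * dpart i f x)) => [x|].
  by rewrite (dpart_comp i (df x) (is_derive_inv (f0 x))) expr2 invfM.
by apply: CdiffM (pf i); apply/CdiffN/CdiffM; apply: IH => //; exact: CdiffW.
Qed.

Lemma Cdiff_expR k f : Cdiff k f -> Cdiff k (fun x => expR (f x)).
Proof.
elim: k f => [|k IH] f Cf; have [df pf] := Cf; split=> //;
  try by move=> x; exact: (differentiable_comp1 (df x) (is_derive_expR _)).
move=> i; apply: (@Cdiff_ext _ (fun x => expR (f x) * dpart i f x)) => [x|].
  by rewrite (dpart_comp i (df x) (is_derive_expR _)).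
by apply: CdiffM (pf i); apply: IH; exact: CdiffW.
Qed.

Lemma Cdiff_ln k f : (forall x, 0 < f x) -> Cdiff k f -> Cdiff k (fun x => ln (f x)).
Proof.
case: k f => [|k] f f0 Cf; have [df pf] := Cf; split=> //;
  try by move=> x; exact: (differentiable_comp1 (df x) (is_derive1_ln (f0 x))).
move=> i; apply: (@Cdiff_ext _ (fun x => (f x)^-1 * dpart i f x)) => [x|].
  by rewrite (dpart_comp i (df x) (is_derive1_ln (f0 x))).
by apply: CdiffM (pf i); apply: CdiffV => [x|]; [rewrite gt_eqF|exact: CdiffW].
Qed.

Lemma derive_dpart f x v : differentiable f x -> 'D_v f x = \sum_i v 0 i * dpart i f x.
Proof.
move=> df; rewrite deriveE// {1}(row_sum_delta v) linear_sum; apply: eq_bigr => i _.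
by rewrite linearZ /= dpartE deriveE.
Qed.

Lemma is_derive_line f p v (t : R) : (forall x, differentiable f x) ->
  is_derive t 1 (fun s => f (p + s *: v)) (\sum_i v 0 i * dpart i f (p + t *: v)).
Proof.
move=> df; rewrite -derive_dpart//.
have E : (fun h : R => h^-1 *: (((fun s => f (p + s *: v)) \o shift t) (h *: 1) - f (p + t *: v)))
   = (fun h => h^-1 *: ((f \o shift (p + t *: v)) (h *: v) - f (p + t *: v))).
  apply/funext => h /=; congr (_ *: (f _ - _)).
  by rewrite scaler1 scalerDl addrCA.
have der := @diff_derivable _ _ _ f (p + t *: v) v (df _).
by apply: DeriveDef; rewrite /derivable /derive /= E.
Qed.

Lemma dpart_shift i f x (a : 'rV[R]_n) : dpart i (fun y => f (y + a)) x = dpart i f (x + a).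
Proof.
rewrite !dpartE /derive.
suff -> : (fun h : R => h^-1 *: (((fun y => f (y + a)) \o shift x) (h *: evec R i) - f (x + a))) =
  (fun h => h^-1 *: ((f \o shift (x + a)) (h *: evec R i) - f (x + a))) by [].
by apply/funext => h /=; rewrite addrA.
Qed.

Lemma differentiable_shift f x (a : 'rV[R]_n) : differentiable f (x + a) ->
  differentiable (fun y => f (y + a)) x.
Proof.
move=> df; apply: (@differentiable_comp _ _ _ _ (fun y => y + a) f) => //.
Qed.

Lemma MVT_dpart i f p (t : R) : (forall x, differentiable f x) -> 0 < t ->
  exists2 c, 0 < c < t & f (p + t *: evec R i) - f p = dpart i f (p + c *: evec R i) * t.
Proof.
move=> df t0.
have dl (s : R) : is_derive s 1 (fun s => f (p + s *: evec R i)) (dpart i f (p + s *: evec R i)).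
  have := is_derive_line p (evec R i) s df; by rewrite -derive_dpart// -dpartE.
have [|c] := @MVT R (fun s => f (p + s *: evec R i)) _ 0 t t0 (fun s _ => dl s).
  by apply: derivable_within_continuous => s _; case: (dl s).
by rewrite in_itv /= scale0r addr0 subr0 => ct E; exists c.
Qed.

Lemma dist_le_split (e a b z : R) :
  `|a - z| < e / 2 -> `|b - z| < e / 2 -> `|a - b| <= e.
Proof. by have := ler_distD z a b; rewrite (distrC z b); lra. Qed.

(* Both mixed partials are values of the same second difference quotient. *)
Lemma dpartC i j f p : Cdiff 2 f -> dpart i (dpart j f) p = dpart j (dpart i f) p.
Proof.
move=> Cf.
(* The mean value theorem is applied to the increment of [f] along [j'], moving in direction [i'],
   and then to [dpart i' f] in direction [j']. *)
have quot i' j' (t : R) : 0 < t -> exists c c', [/\ 0 < c < t, 0 < c' < t &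
    f (p + t *: evec R i' + t *: evec R j') - f (p + t *: evec R i')
     - (f (p + t *: evec R j') - f p) =
    dpart j' (dpart i' f) (p + c *: evec R i' + c' *: evec R j') * t * t].
  move=> t0; pose g y := f (y + t *: evec R j') - f y.
  have df y : differentiable f y by exact: Cdiff_differentiable Cf.
  have dg y : differentiable g y.
    by apply: differentiableB => //; exact: differentiable_shift.
  have [c c0 Ec] := MVT_dpart i' p dg t0.
  have [|c' c'0 Ec'] := @MVT_dpart j' (dpart i' f) (p + c *: evec R i') t _ t0.
    by move=> y; exact: Cdiff_differentiable (Cdiff_dpart i' Cf).
  exists c, c'; split=> //.
  rewrite -Ec' -[LHS]/(g (p + t *: evec R i') - g p) Ec; congr (_ * _).
  rewrite dpartD; [|exact: differentiable_shift|exact/differentiableN/df].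
  by rewrite (dpartN _ (df _)) dpart_shift.
have same (t : R) : 0 < t -> exists c c' d d', [/\ `|c| < t /\ `|c'| < t, `|d| < t /\ `|d'| < t &
    dpart i (dpart j f) (p + (c *: evec R i + c' *: evec R j)) =
    dpart j (dpart i f) (p + (d *: evec R i + d' *: evec R j))].
  move=> t0; have [c' [c [c'0 c0 E1]]] := quot j i t t0.
  have [d [d' [d0 d'0 E2]]] := quot i j t t0.
  have nrm (a : R) : 0 < a < t -> `|a| < t by move=> /andP[a0 ?]; rewrite gtr0_norm.
  exists c, c', d, d'; split; [by split; exact: nrm|by split; exact: nrm|].
  have swap (a1 a1' a2 a3 a4 : R) : a1 = a1' ->
    a1 - a2 - (a3 - a4) = a1' - a3 - (a2 - a4) by move=> ->; ring.
  have tn0 := lt0r_neq0 t0.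
  rewrite (addrC (c *: _)) (addrA p) (addrA p).
  apply: (mulIf tn0); apply: (mulIf tn0).
  apply: (etrans (esym E1)); apply: etrans E2; apply: swap.
  exact: (congr1 f (addrAC _ _ _)).
have near_ k l (e : R) : 0 < e -> exists2 t : R, 0 < t & forall c c', `|c| < t -> `|c'| < t ->
    `|dpart k (dpart l f) p - dpart k (dpart l f) (p + (c *: evec R i + c' *: evec R j))| < e.
  move=> e0.
  have Cc : continuous (dpart k (dpart l f)).
    by apply: (@Cdiff_continuous 0); do 2 apply: Cdiff_dpart.
  have := Cc p => /cvgrPdist_lt/(_ e e0); rewrite near_simpl => /nbhs_normP[r /= r0 H].
  have ev (k' : 'I_n) : `|evec R k'| <= 1.
    rewrite /Num.Def.normr /= mx_normrE; apply/bigmax_leP; split=> // -[a' b] _ /=.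
    by rewrite !mxE; case: (_ && _); rewrite ?normr1 ?normr0.
  exists (r / 2); first by rewrite divr_gt0.
  move=> c c' hc hc'; apply: H => /=; rewrite opprD addrA subrr sub0r normrN.
  apply: (le_lt_trans (ler_normD _ _)); rewrite !normrZ.
  have := ler_wpM2l (normr_ge0 c) (ev i); have := ler_wpM2l (normr_ge0 c') (ev j).
  by rewrite !mulr1; lra.
apply/eqP; rewrite -subr_eq0 -normr_le0; apply/ler_addgt0Pr => e e0; rewrite add0r.
have e20 : 0 < e / 2 by rewrite divr_gt0.
have [t1 t10 H1] := near_ i j _ e20; have [t2 t20 H2] := near_ j i _ e20.
have [|c [c' [d [d' [[hc hc'] [hd hd'] E]]]]] := same (Num.min t1 t2).
  by rewrite lt_min t10.
have := H1 c c'; have := H2 d d'; move: hc hc' hd hd'; rewrite !lt_min.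
move=> /andP[a1 _] /andP[a2 _] /andP[_ a3] /andP[_ a4] /(_ a3 a4) h2 /(_ a1 a2) h1.
by rewrite E in h1; exact: dist_le_split h1 h2.
Qed.

End Calculus.

(** * The drift Laplacian of a matrix field, and Euclidean distance functions *)

Section DriftLaplacian.
Context {R : realType} {n : nat}.
Implicit Types (f g : 'rV[R]_n -> R) (i j k l : 'I_n) (x y p v : 'rV[R]_n).

Lemma dpart2D k l f g x : Cdiff 2 f -> Cdiff 2 g ->
  dpart k (dpart l (fun y => f y + g y)) x = dpart k (dpart l f) x + dpart k (dpart l g) x.
Proof.
move=> Cf Cg; rewrite -(dpartD k (Cdiff_differentiable x (Cdiff_dpart l Cf))
  (Cdiff_differentiable x (Cdiff_dpart l Cg))).
by congr (dpart k _ x); apply/funext => y; apply: dpartD; [exact: Cdiff_differentiable Cf|exact: Cdiff_differentiable Cg].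
Qed.

Lemma dpart2Z k l c f x : Cdiff 2 f ->
  dpart k (dpart l (fun y => c * f y)) x = c * dpart k (dpart l f) x.
Proof.
move=> Cf; rewrite -(dpartZ k c (Cdiff_differentiable x (Cdiff_dpart l Cf))).
by congr (dpart k _ x); apply/funext => y; apply: dpartZ; exact: Cdiff_differentiable Cf.
Qed.

Lemma dpart2M k l f g x : Cdiff 2 f -> Cdiff 2 g ->
  dpart k (dpart l (fun y => f y * g y)) x =
  f x * dpart k (dpart l g) x + g x * dpart k (dpart l f) x
  + (dpart k f x * dpart l g x + dpart l f x * dpart k g x).
Proof.
move=> Cf Cg.
have df y := Cdiff_differentiable y Cf; have dg y := Cdiff_differentiable y Cg.
have dlf y := Cdiff_differentiable y (Cdiff_dpart l Cf).
have dlg y := Cdiff_differentiable y (Cdiff_dpart l Cg).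
transitivity (dpart k (fun y => f y * dpart l g y + g y * dpart l f y) x).
  by congr (dpart k _ x); apply/funext => y; exact: dpartM.
rewrite (dpartD k (differentiableM (df x) (dlg x)) (differentiableM (dg x) (dlf x))).
rewrite (dpartM k (df x) (dlg x)) (dpartM k (dg x) (dlf x)).
ring.
Qed.

Variable S : 'rV[R]_n -> 'M[R]_n.

Definition gradS f g x : R := \sum_k \sum_l S x k l * (dpart k f x * dpart l g x).

Definition hessS f x : R := \sum_k \sum_l S x k l * dpart k (dpart l f) x.

Definition driftlap f x : R := hessS f x - 2^-1 * \sum_k x 0 k * dpart k f x.

Lemma driftlapD f g x : Cdiff 2 f -> Cdiff 2 g ->
  driftlap (fun y => f y + g y) x = driftlap f x + driftlap g x.
Proof.
move=> Cf Cg; rewrite /driftlap /hessS.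
have -> : \sum_k \sum_l S x k l * dpart k (dpart l (fun y => f y + g y)) x =
  \sum_k \sum_l S x k l * dpart k (dpart l f) x + \sum_k \sum_l S x k l * dpart k (dpart l g) x.
  rewrite -big_split /=; apply: eq_bigr => k _; rewrite -big_split /=; apply: eq_bigr => l _.
  by rewrite dpart2D// mulrDr.
have -> : \sum_k x 0 k * dpart k (fun y => f y + g y) x =
  \sum_k x 0 k * dpart k f x + \sum_k x 0 k * dpart k g x.
  rewrite -big_split /=; apply: eq_bigr => k _.
  by rewrite (dpartD k (Cdiff_differentiable x Cf) (Cdiff_differentiable x Cg)) mulrDr.
ring.
Qed.

Lemma driftlapZ c f x : Cdiff 2 f ->
  driftlap (fun y => c * f y) x = c * driftlap f x.
Proof.
move=> Cf; rewrite /driftlap /hessS mulrBr; congr (_ - _).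
  rewrite mulr_sumr; apply: eq_bigr => k _; rewrite mulr_sumr; apply: eq_bigr => l _.
  by rewrite dpart2Z// mulrCA.
rewrite mulrCA; congr (_ * _); rewrite mulr_sumr; apply: eq_bigr => k _.
by rewrite (dpartZ k c (Cdiff_differentiable x Cf)) mulrCA.
Qed.

Hypothesis S_sym : forall x k l, S x k l = S x l k.

(** The drift is a derivation; the second-order part leaves two mixed products of first derivatives,
    which the symmetry of [S] makes equal. *)
Lemma driftlapM f g x : Cdiff 2 f -> Cdiff 2 g ->
  driftlap (fun y => f y * g y) x =
  f x * driftlap g x + g x * driftlap f x + 2 * gradS f g x.
Proof.
move=> Cf Cg; rewrite /driftlap /hessS.
have -> : \sum_k \sum_l S x k l * dpart k (dpart l (fun y => f y * g y)) x =
  f x * (\sum_k \sum_l S x k l * dpart k (dpart l g) x) +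
  g x * (\sum_k \sum_l S x k l * dpart k (dpart l f) x) + 2 * gradS f g x.
  have sw : gradS f g x = \sum_k \sum_l S x k l * (dpart l f x * dpart k g x).
    rewrite /gradS exchange_big /=; apply: eq_bigr => k _; apply: eq_bigr => l _.
    by rewrite S_sym.
  rewrite mulrDl mul1r {2}sw /gradS !mulr_sumr -!big_split /=; apply: eq_bigr => k _.
  rewrite !mulr_sumr -!big_split /=; apply: eq_bigr => l _.
  rewrite dpart2M//; ring.
have -> : \sum_k x 0 k * dpart k (fun y => f y * g y) x =
  f x * (\sum_k x 0 k * dpart k g x) + g x * (\sum_k x 0 k * dpart k f x).
  rewrite !mulr_sumr -big_split /=; apply: eq_bigr => k _.
  rewrite (dpartM k (Cdiff_differentiable x Cf) (Cdiff_differentiable x Cg)); ring.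
ring.
Qed.

Lemma driftlap_cst c x : driftlap (fun=> c) x = 0.
Proof.
rewrite /driftlap /hessS big1 => [|k _]; last first.
  by apply: big1 => l _; rewrite !dpart_cst mulr0.
by rewrite big1 => [|k _]; rewrite ?dpart_cst ?mulr0 ?subr0.
Qed.

Definition sqdist y x : R := \sum_i (x 0 i - y 0 i) ^+ 2.

Lemma Cdiff_sqdist (m : nat) y : Cdiff m (sqdist y).
Proof.
apply: Cdiff_sum => i; apply: (@Cdiff_ext _ _ _ (fun x => (x 0 i - y 0 i) * (x 0 i - y 0 i))).
  by move=> x; rewrite expr2.
by apply: CdiffM; apply: CdiffB; [exact: Cdiff_coord|exact: Cdiff_cst|exact: Cdiff_coord|exact: Cdiff_cst].
Qed.

Lemma dpart_sqdist i y x : dpart i (sqdist y) x = 2 * (x 0 i - y 0 i).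
Proof.
have dc j z : differentiable (fun x => x 0 j - y 0 j) z.
  by apply: (@Cdiff_differentiable _ _ 0); apply: CdiffB; [exact: Cdiff_coord|exact: Cdiff_cst].
have E j : (fun z : 'rV[R]_n => (z 0 j - y 0 j) ^+ 2) =
  (fun z => (z 0 j - y 0 j) * (z 0 j - y 0 j)) by apply/funext => z; rewrite expr2.
have D j : dpart i (fun x => x 0 j - y 0 j) x = (i == j)%:R.
  rewrite (dpartD i (differentiable_coord x 0 j) (differentiable_cst _ _)).
  by rewrite dpart_coord dpart_cst addr0.
rewrite /sqdist dpart_sum => [|j z]; last by rewrite E; exact: differentiableM.
rewrite (bigD1 i)//= E (dpartM i (dc i x) (dc i x)) D eqxx big1 ?addr0 => [|j /negbTE ji].
  by rewrite /= mulr1; ring.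
by rewrite E (dpartM i (dc j x) (dc j x)) D eq_sym ji mulr0 addr0.
Qed.

(** The coefficient 1/2 of the drift cancels the 2 of the gradient. For [y = 0] the subtracted sum
    is the squared norm of [x], which dominates at infinity. *)
Lemma driftlap_sqdist y x :
  driftlap (sqdist y) x = 2 * \tr (S x) - \sum_i x 0 i * (x 0 i - y 0 i).
Proof.
rewrite /driftlap; congr (_ - _).
  rewrite /hessS /mxtrace mulr_sumr; apply: eq_bigr => k _.
  have E l : dpart l (sqdist y) = fun z => 2 * (z 0 l - y 0 l).
    by apply/funext => z; exact: dpart_sqdist.
  have D l : dpart k (dpart l (sqdist y)) x = 2 * (k == l)%:R.
    have dc : differentiable (fun x : 'rV[R]_n => x 0 l - y 0 l) x.
      by apply: (@Cdiff_differentiable _ _ 0); apply: CdiffB; [exact: Cdiff_coord|exact: Cdiff_cst].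
    rewrite E (dpartZ k 2 dc) (dpartD k (differentiable_coord x 0 l) (differentiable_cst _ _)).
    by rewrite dpart_coord dpart_cst addr0.
  rewrite (bigD1 k)//= D eqxx mulr1 mulrC big1 ?addr0// => l /negbTE lk.
  by rewrite D eq_sym lk !mulr0.
rewrite mulr_sumr; apply: eq_bigr => k _; rewrite dpart_sqdist.
by rewrite mulrCA mulKf// pnatr_eq0.
Qed.

Lemma sqdist_ge0 y x : 0 <= sqdist y x.
Proof. by apply: sumr_ge0 => i _; exact: sqr_ge0. Qed.

Lemma sqdist_xx x : sqdist x x = 0.
Proof. by apply: big1 => i _; rewrite subrr expr0n. Qed.

Lemma sqdist_gt0 y x : x != y -> 0 < sqdist y x.
Proof.
move=> xy; rewrite lt_neqAle sqdist_ge0 andbT eq_sym; apply: contra xy.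
rewrite /sqdist psumr_eq0 => [/allP H|i _]; last exact: sqr_ge0.
apply/eqP/rowP => i; apply/eqP; rewrite -subr_eq0 -sqrf_eq0.
by have := H i; rewrite mem_index_enum /=; exact.
Qed.

Lemma sqdist_coord y x i : (x 0 i - y 0 i) ^+ 2 <= sqdist y x.
Proof.
rewrite /sqdist (bigD1 i)//= lerDl; apply: sumr_ge0 => j _; exact: sqr_ge0.
Qed.

Lemma compact_sqdist (A : set 'rV[R]_n) y (c : R) : closed A ->
  (forall x, A x -> sqdist y x <= c) -> compact A.
Proof.
move=> clA Ac; apply: bounded_closed_compact => //.
(* The norm is the sup norm, and [t ^+ 2 <= c] implies [|t| <= c + 1], which avoids a square
   root. *)
exists (c + 1 + `|y|); split; first exact: num_real.
move=> M cM x Ax; apply: le_trans (ltW cM).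
have := ler_normD (x - y) y; rewrite subrK => /le_trans; apply; rewrite lerD2r.
have c0 : 0 <= c by apply: le_trans (Ac x Ax); exact: sqdist_ge0.
rewrite /Num.Def.normr /= mx_normrE; apply/bigmax_leP; split => [|[a i] _ /=].
  by rewrite addr_ge0.
rewrite !mxE !ord1; have := le_trans (sqdist_coord y x i) (Ac x Ax).
move: (x 0 i - y 0 i) => t tc; rewrite ler_norml; apply/andP; split; nra.
Qed.

(** A Euclidean ball lies in the sup-norm ball of the same radius; halving [e] turns the non-strict
    bound into the strict one. *)
Lemma near_sqdist (P : set 'rV[R]_n) y : (\forall x \near y, P x) ->
  exists2 r : R, 0 < r & forall x, sqdist y x <= r -> P x.
Proof.
move=> /nbhs_normP[e /= e0 H]; exists ((e / 2) ^+ 2); first by rewrite exprn_gt0// divr_gt0.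
move=> x xy; apply: H => /=; rewrite distrC.
apply: (@le_lt_trans _ _ (e / 2)); last by lra.
rewrite /Num.Def.normr /= mx_normrE; apply/bigmax_leP; split => [|[a i] _ /=].
  by rewrite divr_ge0// ltW.
rewrite !mxE !ord1; have := le_trans (sqdist_coord y x i) xy.
move: (x 0 i - y 0 i) => t tc.
by rewrite -(ler_pXn2r (ltn0Sn 1)) ?nnegrE ?divr_ge0 ?(ltW e0)// real_normK ?num_real.
Qed.

End DriftLaplacian.

(** * Second-derivative tests and maximum principles *)

Section MaximumPrinciple.
Context {R : realType} {n : nat}.
Implicit Types (f g : 'rV[R]_n -> R) (i j k l : 'I_n) (x y p v : 'rV[R]_n).

Lemma dpart2_line f p v (t : R) : Cdiff 2 f ->
  is_derive t 1 (fun s => \sum_l v 0 l * dpart l f (p + s *: v))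
    (\sum_k \sum_l v 0 k * v 0 l * dpart k (dpart l f) (p + t *: v)).
Proof.
move=> Cf; pose G x := \sum_l v 0 l * dpart l f x.
have dG l y : differentiable (fun x => v 0 l * dpart l f x) y.
  by apply: (@Cdiff_differentiable _ _ 1); apply/CdiffZ/Cdiff_dpart.
have CG : Cdiff 1 G by apply: Cdiff_sum => l; apply/CdiffZ/Cdiff_dpart.
have := is_derive_line p v t (fun y => Cdiff_differentiable y CG).
rewrite (_ : \sum_i _ = \sum_k \sum_l v 0 k * v 0 l * dpart k (dpart l f) (p + t *: v))//.
apply: eq_bigr => k _; rewrite /G dpart_sum// mulr_sumr; apply: eq_bigr => l _.
by rewrite (dpartZ k (v 0 l) (Cdiff_differentiable _ (Cdiff_dpart l Cf))) mulrA.
Qed.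

Lemma near_line p v (P : set 'rV[R]_n) : (\forall x \near p, P x) ->
  exists2 d : R, 0 < d & forall s : R, `|s| < d -> P (p + s *: v).
Proof.
move=> Pp; have c : (fun s : R => p + s *: v) @ (0 : R) --> p.
  rewrite -[X in _ --> X]addr0 -(scale0r v); apply: cvgD; first exact: cvg_cst.
  exact: scalel_continuous.
have /nbhs_normP[d /= d0 H] := c _ Pp.
by exists d => // s sd; apply: H => /=; rewrite sub0r normrN.
Qed.

Lemma local_min_dpart f p i : Cdiff 2 f -> (\forall x \near p, f p <= f x) ->
  dpart i f p = 0.
Proof.
move=> Cf /(near_line (evec R i))[d d0 H].
have df y := Cdiff_differentiable y Cf.
have dl (s : R) := is_derive_line p (evec R i) s df.
have [|s _||s|_] := @derive1_at_min R (fun s => f (p + s *: evec R i)) (- d) d 0.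
- lra.
- by case: (dl s).
- by rewrite in_itv /= d0 oppr_lt0 d0.
- by rewrite in_itv /= scale0r addr0 -ltr_norml; exact: H.
case: (dl 0) => _ -> ; rewrite scale0r addr0 -derive_dpart// => <-.
by rewrite dpartE.
Qed.

(** Along the line through [p], the first derivative [psi] vanishes at 0. Were its derivative
    negative there, [psi] would be negative just to the right of 0, and the mean value theorem would
    put a smaller value of [f] next to [p]. *)
Lemma local_min_hess f p v : Cdiff 2 f -> (\forall x \near p, f p <= f x) ->
  0 <= \sum_k \sum_l v 0 k * v 0 l * dpart k (dpart l f) p.
Proof.
move=> Cf fmin; rewrite leNgt; apply/negP => c0.
have df y := Cdiff_differentiable y Cf.
have [d d0 H] := near_line v fmin.
pose psi (s : R) := \sum_l v 0 l * dpart l f (p + s *: v).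
have psi0 : psi 0 = 0.
  by apply: big1 => l _; rewrite scale0r addr0 (local_min_dpart l Cf fmin) mulr0.
have [dpsi vpsi] := dpart2_line p v 0 Cf.
have : \forall h \near 0^', h^-1 *: ((psi \o shift 0) (h *: 1) - psi 0) < 0.
  have : h^-1 *: ((psi \o shift 0) (h *: 1) - psi 0) @[h --> (0 : R)^'] --> 'D_1 psi 0.
    exact: dpsi.
  by move=> /cvgr_lt; apply; rewrite vpsi scale0r addr0.
move=> /nbhs_normP[e /= e0 He].
pose t := Num.min e d / 2.
have m0 : 0 < Num.min e d by rewrite lt_min e0 d0.
have t0 : 0 < t by rewrite divr_gt0.
have [te td] : t < e /\ t < d.
  by split; apply: (@lt_le_trans _ _ (Num.min e d)); rewrite ?ge_min ?lexx ?orbT// /t; lra.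
have dl (s : R) := is_derive_line p v s df.
have [|c] := @MVT R (fun s => f (p + s *: v)) psi 0 t t0 (fun s _ => dl s).
  by apply: derivable_within_continuous => s _; case: (dl s).
rewrite in_itv /= scale0r addr0 subr0 => /andP[c_gt0 ct] E.
have := He c; rewrite /= sub0r normrN gtr0_norm// => /(_ (lt_trans ct te) (lt0r_neq0 c_gt0)).
rewrite addr0 scaler1 psi0 subr0 -[_ *: _]/(_ * _) pmulr_rlt0 ?invr_gt0// => psic.
have := H t; rewrite gtr0_norm// => /(_ td); rewrite -subr_ge0 E pmulr_lge0//.
by rewrite leNgt psic.
Qed.

Variable S : 'rV[R]_n -> 'M[R]_n.
Hypothesis S_diff : forall k l, Cdiff 0 (fun x => S x k l).
Hypothesis S_gram : forall x, exists m (Y : 'M[R]_(n, m)), S x = Y *m Y^T.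
Hypothesis S_pos : forall x v, v != 0 -> 0 < \sum_k \sum_l v 0 k * v 0 l * S x k l.
Hypothesis S_tr : forall x, \tr (S x) <= n%:R.

Lemma gram_sym x k l : S x k l = S x l k.
Proof.
have [m [Y ->]] := S_gram x; rewrite !mxE; apply: eq_bigr => a _.
by rewrite !mxE mulrC.
Qed.

(** The drift vanishes with the gradient. Writing [S = Y Y^T] turns the second-order part into a
    sum, over the columns of [Y], of second derivatives in the directions of those columns, each
    nonnegative. *)
Lemma driftlap_local_min f p : Cdiff 2 f -> (\forall x \near p, f p <= f x) ->
  0 <= driftlap S f p.
Proof.
move=> Cf fmin; rewrite /driftlap [X in _ - _ * X]big1 ?mulr0 ?subr0 => [|k _]; last first.
  by rewrite (local_min_dpart k Cf fmin) mulr0.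
have [m [Y SY]] := S_gram p.
have -> : hessS S f p = \sum_(a < m) \sum_k \sum_l
    ((col a Y)^T 0 k * (col a Y)^T 0 l * dpart k (dpart l f) p).
  rewrite /hessS [RHS]exchange_big /=; apply: eq_bigr => k _.
  rewrite [RHS]exchange_big /=; apply: eq_bigr => l _.
  by rewrite SY mxE mulr_suml; apply: eq_bigr => a _; rewrite !mxE.
by apply: sumr_ge0 => a _; exact: local_min_hess.
Qed.

Lemma driftlap_continuous f : Cdiff 3 f -> continuous (driftlap S f).
Proof.
move=> Cf; apply: (@Cdiff_continuous _ _ 0); apply: CdiffB.
  apply: Cdiff_sum => k; apply: Cdiff_sum => l; apply: CdiffM => //.
  by apply: CdiffW; do 2 apply: Cdiff_dpart.
apply: CdiffZ; apply: Cdiff_sum => k; apply: CdiffM; first exact: Cdiff_coord.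
by do 2 apply: CdiffW; apply: Cdiff_dpart.
Qed.

(** For every [d > 0] the minimum points of [f + d |x|^2] lie in one ball that does not depend on
    [d]. Hence the minimum of [f] over that ball is global, up to an error that is made arbitrarily
    small. *)
Lemma supersolution_attains_min f : Cdiff 2 f -> (forall x, 0 < f x) ->
  (forall x, driftlap S f x <= 0) -> exists p, forall x, f p <= f x.
Proof.
move=> Cf f0 Lf.
have Cs : Cdiff 2 (sqdist (0 : 'rV[R]_n)) by exact: Cdiff_sqdist.
have cs : continuous (sqdist (0 : 'rV[R]_n)) := Cdiff_continuous Cs.
have cl (c : R) : closed [set x | sqdist (0 : 'rV[R]_n) x <= c].
  by apply: (@closed_comp _ _ (sqdist 0) [set t | t <= c]); [move=> x _; exact: cs|exact: closed_le].
have ball_min g (c : R) : 0 <= c -> continuous g ->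
    exists2 p, sqdist 0 p <= c & forall x, sqdist 0 x <= c -> g p <= g x.
  move=> c0 cg; have [||//|p pA H] := @compact_EVT_min _ R g [set x | sqdist (0 : 'rV[R]_n) x <= c].
  - by exists 0; rewrite /= sqdist_xx.
  - by apply: (@compact_sqdist _ _ _ 0 c).
  - exact: continuous_subspaceT.
  by rewrite inE in pA; exists p => // x xc; apply: H; rewrite inE.
(* Outside [|x|^2 <= 2 n] the drift Laplacian of [|x|^2] is negative, which excludes minima of the
   perturbed function. *)
have [p pn pmin] := ball_min f (2 * n%:R) (mulr_ge0 (ler0n _ _) (ler0n _ _)) (Cdiff_continuous Cf).
exists p => x; apply/ler_addgt0Pr => e e0.
(* This size makes the perturbation raise the value at [x] by at most [e]. *)
pose d := e / (sqdist 0 x + 1).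
have s1 : 0 < sqdist 0 x + 1 by rewrite ltr_wpDl// sqdist_ge0.
have d0 : 0 < d by rewrite divr_gt0.
pose g z := f z + d * sqdist 0 z.
have Cg : Cdiff 2 g by apply: CdiffD => //; exact: CdiffZ.
have gx : g x <= f x + e.
  rewrite lerD2l /d mulrAC ler_pdivrMr// ler_wpM2l ?(ltW e0)//; lra.
(* The ball contains [x], and outside it [d |z|^2] alone exceeds [g x]; since [f] is positive, the
   minimum [q] over the ball is global. *)
have [|q qc qmin] := ball_min g (sqdist 0 x + (g x) / d) _ (Cdiff_continuous Cg).
  rewrite addr_ge0 ?sqdist_ge0// divr_ge0 ?(ltW d0)//.
  by rewrite addr_ge0 ?(ltW (f0 _))// mulr_ge0 ?(ltW d0) ?sqdist_ge0.
have gq z : g q <= g z.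
  have [|zc] := leP (sqdist 0 z) (sqdist 0 x + g x / d); first exact: qmin.
  have gx0 : 0 <= g x.
    by rewrite addr_ge0 ?(ltW (f0 _))// mulr_ge0 ?(ltW d0) ?sqdist_ge0.
  apply: (@le_trans _ _ (g x)); first by apply: qmin; rewrite lerDl divr_ge0 ?(ltW d0).
  have : g x <= d * sqdist 0 z.
    rewrite mulrC -ler_pdivrMr//; apply: ltW; apply: le_lt_trans zc.
    by rewrite lerDr sqdist_ge0.
  by move=> /le_trans; apply; rewrite lerDr ltW.
have : 0 <= driftlap S g q by apply: driftlap_local_min => //; near=> z; exact: gq.
rewrite /g driftlapD//; last exact: CdiffZ.
rewrite driftlapZ// driftlap_sqdist => Lg.
have E : \sum_i q 0 i * (q 0 i - (0 : 'rV[R]_n) 0 i) = sqdist 0 q.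
  by apply: eq_bigr => i _; rewrite !mxE subr0 expr2.
rewrite E in Lg.
have qn : sqdist 0 q <= 2 * n%:R.
  have := Lf q; have := S_tr q; move: Lg; move: (driftlap S f q) (\tr (S q)) => a b.
  move: (sqdist 0 q) n%:R => s N; nra.
apply: le_trans (le_trans (gq x) gx); apply: le_trans (pmin q qn) _.
by rewrite lerDl mulr_ge0 ?(ltW d0) ?sqdist_ge0.
Unshelve. all: by end_near. Qed.

(* Hopf's argument: among the minimum points, z is nearest to y, and the barrier
   h = q + K q^2 - |x - z|^2, with q = |z - y|^2 - |x - y|^2, is a strict subsolution
   near z that is positive only inside the ball about y through z. *)
Lemma supersolution_min_constant f p : Cdiff 2 f ->
  (forall x, driftlap S f x <= 0) -> (forall x, f p <= f x) -> forall y, f y = f p.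
Proof.
move=> Cf Lf fmin y; apply/eqP; rewrite eq_le fmin andbT leNgt; apply/negP => fy.
have cf := Cdiff_continuous Cf.
have Cs (z : 'rV[R]_n) : Cdiff 3 (sqdist z) by exact: Cdiff_sqdist.
have cs (z : 'rV[R]_n) : continuous (sqdist z) := Cdiff_continuous (Cs z).
have cls (z : 'rV[R]_n) (c : R) : closed [set x | sqdist z x <= c].
  by apply: (@closed_comp _ _ (sqdist z) [set t | t <= c]); [move=> x _; exact: cs|exact: closed_le].
have [z fz zmin] : exists2 z, f z = f p & forall x, f x = f p -> sqdist y z <= sqdist y x.
  have [|||z zA H] := @compact_EVT_min _ R (sqdist y)
      (* Cutting with the ball about [y] through [p] gives compactness and discards only points
         farther from [y] than [p]. *)
      ([set x | f x <= f p] `&` [set x | sqdist y x <= sqdist y p]).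
  - by exists p; split; exact: lexx.
  - apply: (@compact_sqdist _ _ _ y (sqdist y p)); last by move=> x [].
    apply: closedI => //.
    by apply: (@closed_comp _ _ f [set t | t <= f p]); [move=> x _; exact: cf|exact: closed_le].
  - exact: continuous_subspaceT.
  move: zA; rewrite inE => -[/= fzp zp]; exists z; first by apply/eqP; rewrite eq_le fzp fmin.
  move=> x fx; have [xp|/ltW] := leP (sqdist y x) (sqdist y p); last exact: le_trans.
  by apply: H; rewrite inE; split => //=; rewrite fx.
have zy : z != y by apply/eqP => zy; move: fy; rewrite -zy fz ltxx.
pose q x := sqdist y z - sqdist y x.
have Cq : Cdiff 3 q by apply: CdiffB; [exact: Cdiff_cst|exact: Cs].
have cq := Cdiff_continuous Cq.
have q0 : q z = 0 by rewrite /q subrr.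
have fq x : 0 < q x -> f p < f x.
  move=> qx; rewrite lt_neqAle fmin andbT; apply/eqP => fx.
  by have := zmin x (esym fx); rewrite leNgt -subr_gt0 qx.
(* The gradient of [q] at [z] is [2 (y - z)], nonzero, so [S_pos] applies. *)
have grad_pos : 0 < gradS S q q z.
  have dq k : dpart k q z = 2 * (y - z) 0 k.
    rewrite /q (dpartD k (differentiable_cst _ _)); last first.
      by apply: differentiableN; exact: Cdiff_differentiable (Cs y).
    rewrite dpart_cst add0r (dpartN k (Cdiff_differentiable z (Cs y))) dpart_sqdist !mxE.
    by rewrite -mulrN opprB.
  have -> : gradS S q q z = 4 * \sum_k \sum_l (y - z) 0 k * (y - z) 0 l * S z k l.
    rewrite /gradS mulr_sumr; apply: eq_bigr => k _; rewrite mulr_sumr; apply: eq_bigr => l _.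
    by rewrite !dq; move: ((y - z) 0 k) ((y - z) 0 l) (S z k l) => a b c; ring.
  by rewrite mulr_gt0// S_pos// subr_eq0 eq_sym.
(* As [q z = 0], the term [K q^2] contributes [K * (2 * gradS S q q z)] to the drift Laplacian of
   [h] at [z]. This [K] makes that contribution outweigh the remaining terms by at least 1. *)
pose K := (`|driftlap S q z - driftlap S (sqdist z) z| + 1) / (2 * gradS S q q z).
have K0 : 0 < K by rewrite divr_gt0 ?mulr_gt0// ltr_wpDl.
pose h x := q x + K * (q x * q x) - sqdist z x.
have Cqq : Cdiff 3 (fun x => q x * q x) by exact: CdiffM.
have Ch : Cdiff 3 h by apply: CdiffB => //; apply: CdiffD => //; exact: CdiffZ.
have Lhz : 0 < driftlap S h z.
  have -> : driftlap S h z = driftlap S q z - driftlap S (sqdist z) z + K * (2 * gradS S q q z).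
    have -> : h = fun x => (q x + K * (q x * q x)) + (-1) * sqdist z x.
      by apply/funext => x; rewrite /h mulN1r.
    have Cq2 := CdiffW Cq; have Cqq2 := CdiffW Cqq; have Cz2 := CdiffW (Cs z).
    rewrite (driftlapD _ _ (CdiffD Cq2 (CdiffZ K Cqq2)) (CdiffZ (-1) Cz2)).
    rewrite (driftlapD _ _ Cq2 (CdiffZ K Cqq2)) (driftlapZ _ _ _ Cqq2) (driftlapZ _ _ _ Cz2).
    by rewrite (driftlapM gram_sym _ Cq2 Cq2) q0 !mul0r !add0r mulN1r addrAC.
  rewrite /K divfK; last by rewrite mulf_neq0// gt_eqF.
  move: (_ - _) => a; have := ler_norm (- a); rewrite normrN; lra.
have [r r0 near_z] : exists2 r : R, 0 < r &
    forall x, sqdist z x <= r -> 0 < driftlap S h x /\ 0 < 1 + K * q x.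
  apply: near_sqdist; near=> x; split; near: x.
    have cL : continuous (driftlap S h) := driftlap_continuous Ch.
    by move: (cL z) => /cvgr_gt; apply.
  have c1 : continuous (fun x => 1 + K * q x).
    exact: (Cdiff_continuous (CdiffD (Cdiff_cst 3 1) (CdiffZ K Cq))).
  by move: (c1 z) => /cvgr_gt; apply; rewrite q0 mulr0 addr0.
(* On the sphere, [0 <= h x] reads [r <= q (1 + K q)], and the second factor is positive near
   [z]. *)
have hpos x : sqdist z x = r -> 0 <= h x -> 0 < q x.
  move=> xr hx; have [|_ K1] := near_z x; first by rewrite xr.
  move: hx K1; rewrite /h xr; move: (q x) => a; nra.
have q_le x : q x <= sqdist y z by rewrite /q gerBl sqdist_ge0.
pose H := sqdist y z + K * (sqdist y z * sqdist y z).
have r2 : 0 < sqdist y z by exact: (sqdist_gt0 zy).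
have H0 : 0 < H by apply: addr_gt0 => //; do 2 apply: mulr_gt0 => //.
(* The part of the sphere where [h] is nonnegative is compact and [f] exceeds its minimum there, so
   the gap has a positive lower bound; the value 1 serves when that part is empty. *)
have [d d0 dmin] : exists2 d : R, 0 < d &
    forall x, sqdist z x = r -> 0 <= h x -> f p + d <= f x.
  pose A := [set x | sqdist z x <= r] `&` [set x | r <= sqdist z x] `&` [set x | 0 <= h x].
  have [A0|/set0P] := eqVneq A set0.
    exists 1 => // x xr hx; exfalso; suff : A x by rewrite A0.
    by split=> //; split; rewrite /= xr.
  move=> /compact_EVT_min /(_ _ (continuous_subspaceT cf)) [|a aA amin].
    apply: (@compact_sqdist _ _ _ z r); last by move=> x [[]].
    apply: closedI; first apply: closedI => //.
      by apply: (@closed_comp _ _ (sqdist z) [set t | r <= t]); [move=> x _; exact: cs|exact: closed_ge].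
    by apply: (@closed_comp _ _ h [set t | 0 <= t]); [move=> x _; exact: (Cdiff_continuous Ch)|exact: closed_ge].
  move: aA; rewrite inE => -[[/= ar1 ar2] ha].
  exists (f a - f p); first by rewrite subr_gt0; apply/fq/hpos => //; apply/eqP; rewrite eq_le ar1.
  by move=> x xr hx; rewrite subrKC; apply: amin; rewrite inE; split=> //; split; rewrite /= xr.
(* [H] bounds [h] on the sphere, so subtracting [eps * h] there costs at most the gap [d]. *)
pose eps := d / H.
have eps0 : 0 < eps by rewrite divr_gt0.
pose psi x := f x + (- eps) * h x.
have Cpsi : Cdiff 2 psi by apply: CdiffD => //; apply/CdiffZ/CdiffW.
have Lpsi x : sqdist z x <= r -> driftlap S psi x < 0.
  move=> /near_z[Lh _]; rewrite /psi driftlapD ?driftlapZ//; do ?[exact: CdiffW|exact/CdiffZ/CdiffW].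
  have := Lf x; move: (driftlap S h x) Lh (driftlap S f x) => a a0 b b0; nra.
have hz : h z = 0 by rewrite /h q0 sqdist_xx mulr0 mulr0 addr0 subr0.
have psiz : psi z = f p by rewrite /psi hz mulr0 addr0.
have psi_bd x : sqdist z x = r -> f p <= psi x.
  move=> xr; have [hx|hx] := leP 0 (h x); last first.
    rewrite /psi; have := fmin x; move: (f x) (f p) => a b; nra.
  have hH : h x <= H.
    have := hpos x xr hx; have := q_le x; rewrite /h /H xr; move: (q x) (sqdist y z) r2 => a b b0 ab a0.
    have : K * (a * a) <= K * (b * b) by rewrite ler_pM2l// ler_pM// ltW.
    by move: r0; lra.
  have : eps * h x <= d by rewrite /eps mulrAC ler_pdivrMr// ler_pM2l.
  rewrite /psi mulNr; have := dmin x xr hx; lra.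
have min_int a : sqdist z a < r -> (forall x, sqdist z x <= r -> psi a <= psi x) -> False.
  move=> ar amin; have := Lpsi a (ltW ar); rewrite ltNge driftlap_local_min//.
  near=> x; apply: amin; apply: ltW; near: x.
  by move: (cs z a) => /cvgr_lt; apply.
have [|||a aA amin] := @compact_EVT_min _ R psi [set x | sqdist z x <= r].
- by exists z; rewrite /= sqdist_xx ltW.
- by apply: (@compact_sqdist _ _ _ z r).
- exact: (continuous_subspaceT (Cdiff_continuous Cpsi)).
rewrite inE /= in aA.
have [ar|ra] := ltP (sqdist z a) r.
  by apply: (min_int a ar) => x xr; apply: amin; rewrite inE.
(* A minimum on the sphere has value at least [f p = psi z], so the centre [z] is an interior
   minimum as well, which contradicts [Lpsi]. *)
apply: (min_int z); first by rewrite sqdist_xx.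
move=> x xr; rewrite psiz; apply: le_trans (amin x _); last by rewrite inE.
by apply: psi_bd; apply/eqP; rewrite eq_le aA.
Unshelve. all: by end_near. Qed.

End MaximumPrinciple.

(** * Differentiation of matrix products, inverses and log-determinants *)

Section MatrixCalculus.
Context {R : realType} {n : nat}.
Implicit Types (i : 'I_n) (x : 'rV[R]_n).

Definition Cdiffmx (k p q : nat) (M : 'rV[R]_n -> 'M[R]_(p, q)) : Prop :=
  forall a b, Cdiff k (fun x => M x a b).

Definition dpartmx (p q : nat) i (M : 'rV[R]_n -> 'M[R]_(p, q)) x : 'M[R]_(p, q) :=
  \matrix_(a, b) dpart i (fun y => M y a b) x.

Lemma Cdiff_det k p (M : 'rV[R]_n -> 'M[R]_p) : Cdiffmx k M -> Cdiff k (fun x => \det (M x)).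
Proof.
move=> CM; apply: Cdiff_sum => s; apply: CdiffZ; apply: Cdiff_prod => a; exact: CM.
Qed.

Lemma Cdiffmx_mul k p q r (A : 'rV[R]_n -> 'M[R]_(p, q)) (B : 'rV[R]_n -> 'M[R]_(q, r)) :
  Cdiffmx k A -> Cdiffmx k B -> Cdiffmx k (fun x => A x *m B x).
Proof.
move=> CA CB a b; apply: (@Cdiff_ext _ _ _ (fun x => \sum_c A x a c * B x c b)).
  by move=> x; rewrite mxE.
by apply: Cdiff_sum => c; apply: CdiffM.
Qed.

(** By Cramer's rule the entries of the inverse are cofactors divided by the determinant. *)
Lemma Cdiffmx_inv k p (M : 'rV[R]_n -> 'M[R]_p) : (forall x, M x \in unitmx) ->
  Cdiffmx k M -> Cdiffmx k (fun x => invmx (M x)).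
Proof.
move=> uM CM a b.
apply: (@Cdiff_ext _ _ _ (fun x => (\det (M x))^-1 * cofactor (M x) b a)).
  by move=> x; rewrite /invmx uM !mxE.
apply: CdiffM.
  apply: CdiffV; last exact: Cdiff_det.
  by move=> x; have := uM x; rewrite unitmxE unitfE.
rewrite /cofactor; apply: CdiffZ; apply: Cdiff_det => c d.
by apply: Cdiff_ext (CM (lift b c) (lift a d)) => x; rewrite !mxE.
Qed.

Lemma dpartmx_mul k p q r i (A : 'rV[R]_n -> 'M[R]_(p, q)) (B : 'rV[R]_n -> 'M[R]_(q, r)) x :
  Cdiffmx k A -> Cdiffmx k B ->
  dpartmx i (fun x => A x *m B x) x = dpartmx i A x *m B x + A x *m dpartmx i B x.
Proof.
move=> CA CB; apply/matrixP => a b; rewrite !mxE.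
have dA c d y := Cdiff_differentiable y (CA c d).
have dB c d y := Cdiff_differentiable y (CB c d).
transitivity (dpart i (fun y => \sum_c A y a c * B y c b) x).
  by congr (dpart i _ x); apply/funext => y; rewrite mxE.
rewrite dpart_sum => [|c y]; last by apply: differentiableM; [exact: dA|exact: dB].
rewrite -big_split /=; apply: eq_bigr => c _.
by rewrite (dpartM i (dA a c x) (dB c b x)) !mxE [in LHS]addrC [B x c b * _]mulrC.
Qed.

Lemma dpartmx_cst p q i (C : 'M[R]_(p, q)) x : dpartmx i (fun=> C) x = 0.
Proof. by apply/matrixP => a b; rewrite !mxE dpart_cst. Qed.

(** Differentiate [M M^-1 = 1] and multiply on the left by the inverse. *)
Lemma dpartmx_inv k p i (M : 'rV[R]_n -> 'M[R]_p) x : (forall x, M x \in unitmx) ->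
  Cdiffmx k M ->
  dpartmx i (fun y => invmx (M y)) x = - (invmx (M x) *m dpartmx i M x *m invmx (M x)).
Proof.
move=> uM CM; have := dpartmx_mul i x CM (Cdiffmx_inv uM CM).
have -> : (fun y => M y *m invmx (M y)) = fun=> 1%:M by apply/funext => y; rewrite mulmxV.
rewrite dpartmx_cst => /(congr1 (mulmx (invmx (M x)))).
rewrite mulmx0 mulmxDr mulKmx// mulmxA => /eqP.
by rewrite eq_sym addrC addr_eq0 => /eqP.
Qed.

(** Uniqueness of [r] ensures that the condition [b != a] drops exactly one factor. *)
Lemma dpart_prod i (T : eqType) (r : seq T) (F : T -> 'rV[R]_n -> R) x :
  uniq r -> (forall a, Cdiff 0 (F a)) ->
  dpart i (fun y => \prod_(a <- r) F a y) x =
  \sum_(a <- r) dpart i (F a) x * \prod_(b <- r | b != a) F b x.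
Proof.
move=> + CF; have dF a y := Cdiff_differentiable y (CF a).
elim: r => [_|c r IH /= /andP[cr ur]].
  rewrite big_nil; transitivity (dpart i (fun=> 1) x); last by rewrite dpart_cst.
  by congr (dpart i _ x); apply/funext => y; rewrite big_nil.
transitivity (dpart i (fun y => F c y * \prod_(a <- r) F a y) x).
  by congr (dpart i _ x); apply/funext => y; rewrite big_cons.
rewrite (dpartM i (dF c x) (Cdiff_differentiable x (Cdiff_prod r xpredT CF))) IH//.
rewrite !big_cons eqxx /= addrC; congr (_ + _).
  rewrite mulrC; congr (_ * _); rewrite [LHS]big_seq [RHS]big_seq_cond.
  apply: eq_bigl => b; case br: (b \in r) => //=.
  by case: eqP => // bc; rewrite -bc br in cr.
rewrite mulr_sumr; apply: eq_big_seq => a ar.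
rewrite big_cons; case: eqP => [ca|_]; last by rewrite mulrCA.
by rewrite ca ar in cr.
Qed.

(** Jacobi's formula, by the Leibniz expansion: the derivative is the sum of the determinants in
    which one row has been differentiated. *)
Lemma dpart_det i p (M : 'rV[R]_n -> 'M[R]_p) x : Cdiffmx 0 M ->
  dpart i (fun y => \det (M y)) x = \tr (\adj (M x) *m dpartmx i M x).
Proof.
move=> CM; set dM := dpartmx i M x.
(* [A a] differs from [M x] only in row [a], so expanding along that row brings in the cofactors of
   [M x]. *)
pose A a := \matrix_(b, c) (if b == a then dM a c else M x b c) : 'M[R]_p.
have Edet a : \det (A a) = \sum_c dM a c * cofactor (M x) a c.
  rewrite (expand_det_row _ a); apply: eq_bigr => c _; rewrite mxE eqxx; congr (_ * (_ * \det _)).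
  by apply/matrixP => b d; rewrite !mxE eq_sym (negbTE (neq_lift _ _)).
transitivity (\sum_a \det (A a)); last first.
  rewrite mxtrace_mulC; apply: eq_bigr => a _; rewrite Edet mxE.
  by apply: eq_bigr => c _; rewrite [\adj _ _ _]mxE.
rewrite /determinant exchange_big /=.
rewrite dpart_sum => [|s y]; last first.
  by apply: (@Cdiff_differentiable _ _ 0); apply/CdiffZ/Cdiff_prod => a; exact: CM.
apply: eq_bigr => s _; rewrite dpartZ; last first.
  by apply: (@Cdiff_differentiable _ _ 0); apply: Cdiff_prod => a; exact: CM.
rewrite -mulr_sumr; congr (_ * _).
rewrite dpart_prod ?index_enum_uniq//.
apply: eq_bigr => a _; rewrite [RHS](bigD1 a)//= !mxE eqxx; congr (_ * _).
by apply: eq_bigr => b /negbTE ba; rewrite mxE ba.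
Qed.

Lemma dpart_trace k p i (M : 'rV[R]_n -> 'M[R]_p) x : Cdiffmx k M ->
  dpart i (fun y => \tr (M y)) x = \tr (dpartmx i M x).
Proof.
move=> CM; rewrite /mxtrace dpart_sum => [|a y]; last exact: Cdiff_differentiable (CM a a).
by apply: eq_bigr => a _; rewrite mxE.
Qed.

Section LogDet.
Variables (p : nat) (M : 'rV[R]_n -> 'M[R]_p).
Hypothesis M_unit : forall x, M x \in unitmx.

(* The square makes the argument of [ln] positive without knowing the sign of the determinant. *)
Definition lndet2 x : R := ln (\det (M x) ^+ 2).

Lemma det2_gt0 x : 0 < \det (M x) ^+ 2.
Proof. by rewrite exprn_even_gt0//= -unitfE -unitmxE. Qed.

Lemma Cdiff_det2 k : Cdiffmx k M -> Cdiff k (fun x => \det (M x) ^+ 2).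
Proof.
move=> CM; apply: (@Cdiff_ext _ _ _ (fun x => \det (M x) * \det (M x))) => [x|].
  by rewrite expr2.
by apply: CdiffM; exact: Cdiff_det.
Qed.

Lemma Cdiff_lndet2 k : Cdiffmx k M -> Cdiff k lndet2.
Proof. by move=> CM; apply: Cdiff_ln; [exact: det2_gt0|exact: Cdiff_det2]. Qed.

Lemma dpart_lndet2 i x : Cdiffmx 0 M ->
  dpart i lndet2 x = 2 * \tr (invmx (M x) *m dpartmx i M x).
Proof.
move=> CM; have d0 : \det (M x) != 0 by rewrite -unitfE -unitmxE.
have dd := Cdiff_differentiable x (Cdiff_det CM).
rewrite /lndet2 (dpart_comp i _ (is_derive1_ln (det2_gt0 x))); last first.
  exact: Cdiff_differentiable (Cdiff_det2 CM).
transitivity ((\det (M x) ^+ 2)^-1 * dpart i (fun y => \det (M y) * \det (M y)) x).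
  by congr (_ * dpart i _ x); apply/funext => y; rewrite expr2.
rewrite (dpartM i dd dd) dpart_det//.
rewrite /invmx M_unit -scalemxAl mxtraceZ; move: (\tr _) (\det _) d0 => t d d0.
by field.
Qed.

(** The first derivative is [2 tr (M^-1 dM)]; the subtracted trace comes from differentiating
    [M^-1]. *)
Lemma dpart2_lndet2 i j x : Cdiffmx 2 M ->
  dpart i (dpart j lndet2) x =
  2 * (\tr (invmx (M x) *m dpartmx i (dpartmx j M) x)
       - \tr (invmx (M x) *m dpartmx i M x *m invmx (M x) *m dpartmx j M x)).
Proof.
move=> CM.
have C1 : Cdiffmx 1 M by move=> a b; apply: CdiffW; exact: CM.
have CjM : Cdiffmx 1 (dpartmx j M).
  move=> a b; apply: (@Cdiff_ext _ _ _ (dpart j (fun y => M y a b))) => [y|]; first by rewrite mxE.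
  by apply: Cdiff_dpart; exact: CM.
have CI := Cdiffmx_inv M_unit C1.
have CP := Cdiffmx_mul CI CjM.
have dtr : differentiable (fun y => \tr (invmx (M y) *m dpartmx j M y)) x.
  apply: (@Cdiff_differentiable _ _ 1); apply: Cdiff_sum => a; exact: CP.
transitivity (dpart i (fun y => 2 * \tr (invmx (M y) *m dpartmx j M y)) x).
  congr (dpart i _ x); apply/funext => y; apply: dpart_lndet2 => a b.
  by do 2 apply: CdiffW; exact: CM.
rewrite (dpartZ i 2 dtr) (dpart_trace i x CP) (dpartmx_mul i x CI CjM) (dpartmx_inv i x M_unit C1).
by rewrite mxtraceD mulNmx addrC -scaleN1r mxtraceZ mulN1r.
Qed.

End LogDet.

End MatrixCalculus.

(** * Passage from vector-valued derivatives to components *)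

Section VectorFields.
Context {R : realType} {n : nat}.
Implicit Types (i j : 'I_n) (x y : 'rV[R]_n).

Definition rowc (k : nat) (f : 'rV[R]_n -> 'rV[R]_k) (a : 'I_k) : 'rV[R]_n -> R :=
  fun y => f y 0 a.

Lemma differentiable_row (k : nat) (f : 'rV[R]_n -> 'rV[R]_k) x :
  (forall a, differentiable (rowc f a) x) -> differentiable f x.
Proof.
move=> df; have -> : f = fun y => \sum_a rowc f a y *: evec R a.
  by apply/funext => y; rewrite {1}(row_sum_delta (f y)).
have -> : (fun y => \sum_a rowc f a y *: evec R a) = \sum_a (fun y => rowc f a y *: evec R a).
  by apply/funext => y; rewrite fct_sumE.
by apply: differentiable_sum => a; exact: differentiableZl.
Qed.

Lemma pdE (k : nat) i (f : 'rV[R]_n -> 'rV[R]_k) x :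
  (forall a, differentiable (rowc f a) x) -> pd i f x = \row_a dpart i (rowc f a) x.
Proof.
move=> df; rewrite /pd derive_mx; last exact/diff_derivable/differentiable_row.
by apply/rowP => a; rewrite !mxE dpartE.
Qed.

(** The head of the list in [iter_pd] is the outermost derivative, whereas [Cdiff] peels off the
    innermost one; this lemma reconciles the two orders. *)
Lemma iter_pd_rcons (k : nat) l i (f : 'rV[R]_n -> 'rV[R]_k) :
  iter_pd l (pd i f) = iter_pd (rcons l i) f.
Proof. by elim: l => //= j l ->. Qed.

Lemma smooth_Cdiff (k : nat) (f : 'rV[R]_n -> 'rV[R]_k) : smooth f ->
  forall (N : nat) a, Cdiff N (rowc f a).
Proof.
move=> sf N; elim: N f sf => [|N IH] f sf a.
  split=> // x; apply: (@differentiable_comp _ _ _ _ f (fun v => v 0 a)); first exact: (sf [::]).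
  exact: differentiable_coord.
have df b y : differentiable (rowc f b) y.
  apply: (@differentiable_comp _ _ _ _ f (fun v => v 0 b)); first exact: (sf [::]).
  exact: differentiable_coord.
split=> // i; apply: (@Cdiff_ext _ _ _ (rowc (pd i f) a)) => [x|].
  by rewrite /rowc pdE// mxE.
by apply: IH => l x; rewrite iter_pd_rcons; exact: sf.
Qed.

Lemma rowc_pd (k : nat) i (f : 'rV[R]_n -> 'rV[R]_k) a :
  (forall N a, Cdiff N (rowc f a)) -> rowc (pd i f) a = dpart i (rowc f a).
Proof.
move=> Cf; apply/funext => x; rewrite /rowc pdE ?mxE// => b.
exact: Cdiff_differentiable (Cf 0%N b).
Qed.

Lemma Cdiff_smooth (k : nat) (f : 'rV[R]_n -> 'rV[R]_k) :
  (forall N a, Cdiff N (rowc f a)) -> smooth f.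
Proof.
move=> Cf l; suff Cl N a : Cdiff N (rowc (iter_pd l f) a).
  by move=> x; apply: differentiable_row => a; exact: Cdiff_differentiable (Cl 0%N a).
elim: l N a => [|i l IH] N a; first exact: Cf.
by rewrite /= rowc_pd//; apply: Cdiff_dpart; exact: IH.
Qed.

Lemma dotvE (k : nat) (a b : 'rV[R]_k) : dotv a b = \sum_c a 0 c * b 0 c.
Proof. by rewrite /dotv mxE; apply: eq_bigr => c _; rewrite mxE. Qed.

Lemma dotvC (k : nat) (a b : 'rV[R]_k) : dotv a b = dotv b a.
Proof. by rewrite !dotvE; apply: eq_bigr => c _; rewrite mulrC. Qed.

Lemma dotvBl (k : nat) (a b c : 'rV[R]_k) : dotv (a - b) c = dotv a c - dotv b c.
Proof. by rewrite /dotv mulmxBl !mxE. Qed.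

Lemma dotvNl (k : nat) (a c : 'rV[R]_k) : dotv (- a) c = - dotv a c.
Proof. by rewrite /dotv mulNmx !mxE. Qed.

Lemma dotvZl (k : nat) (t : R) (a c : 'rV[R]_k) : dotv (t *: a) c = t * dotv a c.
Proof. by rewrite /dotv -scalemxAl mxE. Qed.

Lemma dotv0l (k : nat) (c : 'rV[R]_k) : dotv 0 c = 0.
Proof. by rewrite /dotv mul0mx mxE. Qed.

Lemma dotv_suml (k : nat) (I : Type) (r : seq I) (F : I -> 'rV[R]_k) c :
  dotv (\sum_(a <- r) F a) c = \sum_(a <- r) dotv (F a) c.
Proof.
by rewrite /dotv mulmx_suml summxE.
Qed.

Lemma dotv_row_mx (k l : nat) (a c : 'rV[R]_k) (b d : 'rV[R]_l) :
  dotv (row_mx a b) (row_mx c d) = dotv a c + dotv b d.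
Proof. by rewrite /dotv tr_row_mx mul_row_col mxE. Qed.

Lemma dotv_evecl (k : nat) (a : 'I_k) (b : 'rV[R]_k) : dotv (evec R a) b = b 0 a.
Proof. by rewrite /dotv /evec -rowE !mxE. Qed.

Lemma Cdiff_dotv (N k : nat) (A B : 'rV[R]_n -> 'rV[R]_k) :
  (forall a, Cdiff N (rowc A a)) -> (forall a, Cdiff N (rowc B a)) ->
  Cdiff N (fun x => dotv (A x) (B x)).
Proof.
move=> CA CB; apply: (@Cdiff_ext _ _ _ (fun x => \sum_c rowc A c x * rowc B c x)) => [x|].
  by rewrite dotvE.
by apply: Cdiff_sum => c; apply: CdiffM.
Qed.

Lemma dpart_dotv (k : nat) i (A B : 'rV[R]_n -> 'rV[R]_k) x :
  (forall a, Cdiff 0 (rowc A a)) -> (forall a, Cdiff 0 (rowc B a)) ->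
  dpart i (fun y => dotv (A y) (B y)) x = dotv (pd i A x) (B x) + dotv (A x) (pd i B x).
Proof.
move=> CA CB.
have dA a y := Cdiff_differentiable y (CA a); have dB a y := Cdiff_differentiable y (CB a).
transitivity (dpart i (fun y => \sum_c rowc A c y * rowc B c y) x).
  by congr (dpart i _ x); apply/funext => y; rewrite dotvE.
rewrite dpart_sum => [|c y]; last by apply: differentiableM; [exact: dA|exact: dB].
rewrite !dotvE -big_split /=; apply: eq_bigr => c _.
rewrite (dpartM i (dA c x) (dB c x)) !pdE// !mxE addrC; congr (_ + _).
by rewrite mulrC.
Qed.

End VectorFields.

(** * Geometry of a graph: metric, normal frame, shrinker and Ricci equations *)

Section GraphGeometry.
Context {R : realType} {n m : nat}.
Variable u : 'rV[R]_n -> 'rV[R]_m.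
Hypothesis u_smooth : smooth u.
Implicit Types (i j k l : 'I_n) (al be : 'I_m) (x y : 'rV[R]_n).

Definition grad x : 'M[R]_(n, m) := \matrix_(i, al) dpart i (rowc u al) x.

Definition hess al x : 'M[R]_n := \matrix_(i, j) dpart i (dpart j (rowc u al)) x.

Definition gmx x : 'M[R]_n := 1%:M + grad x *m (grad x)^T.

Definition Smx x : 'M[R]_n := invmx (gmx x).

(** The standard frame of the normal bundle of a graph. It is not orthonormal: its Gram matrix is
    [1 + D^T D]. *)
Definition normalv al x : 'rV[R]_(n + m) := row_mx (- \row_i dpart i (rowc u al) x) (evec R al).

Let Cu N al : Cdiff N (rowc u al).
Proof. exact: smooth_Cdiff. Qed.

Lemma Cdiff_dpartu N i al : Cdiff N (dpart i (rowc u al)).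
Proof. by apply: Cdiff_dpart; exact: Cu. Qed.

Lemma hess_sym al x : (hess al x)^T = hess al x.
Proof. by apply/matrixP => i j; rewrite !mxE dpartC. Qed.

Lemma Cdiff_grad N : Cdiffmx N grad.
Proof.
move=> i al; apply: (@Cdiff_ext _ _ _ (dpart i (rowc u al))) => [x|].
  by rewrite mxE.
exact: Cdiff_dpartu.
Qed.

Lemma Cdiff_gmx N : Cdiffmx N gmx.
Proof.
move=> i j; apply: (@Cdiff_ext _ _ _ (fun x => (1%:M : 'M[R]_n) i j + (grad x *m (grad x)^T) i j)) => [x|].
  by rewrite [RHS]mxE.
apply: CdiffD; first exact: Cdiff_cst.
apply: (@Cdiffmx_mul _ _ _ _ _ _ grad (fun x => (grad x)^T)); first exact: Cdiff_grad.
by move=> al k; apply: Cdiff_ext (@Cdiff_grad N k al) => x; rewrite [RHS]mxE.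
Qed.

(** If [v g = 0] then [v g v^T = |v|^2 + |v D|^2] vanishes, hence so does [v]. *)
Lemma gmx_unit x : gmx x \in unitmx.
Proof.
rewrite -row_free_unit -kermx_eq0; apply/rowV0P => v /sub_kermxP vg.
have : dotv v v + dotv (v *m grad x) (v *m grad x) = 0.
  transitivity ((v *m gmx x *m v^T) 0 0); last by rewrite vg mul0mx mxE.
  by rewrite /dotv /gmx mulmxDr mulmx1 mulmxDl [RHS]mxE trmx_mul !mulmxA.
have sq (N : nat) (w : 'rV[R]_N) : 0 <= dotv w w.
  by rewrite dotvE; apply: sumr_ge0 => a _; rewrite -expr2 sqr_ge0.
move=> /eqP; rewrite paddr_eq0 ?sq// => /andP[/eqP v0 _].
apply/rowP => a; rewrite mxE; apply/eqP; rewrite -sqrf_eq0; apply/eqP.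
move: v0; rewrite dotvE => /eqP; rewrite psumr_eq0 => [/allP/(_ a)|b _].
  by rewrite mem_index_enum /= -expr2 => /(_ isT)/eqP.
by rewrite -expr2 sqr_ge0.
Qed.

Lemma gmx_sym x : (gmx x)^T = gmx x.
Proof. by rewrite /gmx linearD /= trmx1 trmx_mul trmxK. Qed.

Lemma Smx_sym x : (Smx x)^T = Smx x.
Proof. by rewrite /Smx trmx_inv gmx_sym. Qed.

Lemma Cdiff_Smx N : Cdiffmx N Smx.
Proof. by apply: Cdiffmx_inv; [exact: gmx_unit|exact: Cdiff_gmx]. Qed.

Lemma pd_row_mx (k l : nat) i (a : 'rV[R]_n -> 'rV[R]_k) (b : 'rV[R]_n -> 'rV[R]_l) x :
  (forall c, differentiable (rowc a c) x) -> (forall c, differentiable (rowc b c) x) ->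
  pd i (fun y => row_mx (a y) (b y)) x = row_mx (pd i a x) (pd i b x).
Proof.
move=> da db.
have El c : rowc (fun y => row_mx (a y) (b y)) (lshift l c) = rowc a c.
  by apply/funext => y; rewrite /rowc row_mxEl.
have Er c : rowc (fun y => row_mx (a y) (b y)) (rshift k c) = rowc b c.
  by apply/funext => y; rewrite /rowc row_mxEr.
rewrite pdE; last by move=> c; case: (split_ordP c) => c' ->; rewrite ?El ?Er.
apply/rowP => c; rewrite mxE; case: (split_ordP c) => c' ->.
  by rewrite El row_mxEl pdE// mxE.
by rewrite Er row_mxEr pdE// mxE.
Qed.

Let du al x : differentiable (rowc u al) x.
Proof. exact: Cdiff_differentiable (Cu 0 al). Qed.

Lemma tangentE i x : tangent u i x = row_mx (evec R i) (\row_al dpart i (rowc u al) x).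
Proof.
rewrite /tangent /graph_map pd_row_mx//; last by move=> c; exact: differentiable_coord.
rewrite [pd i u x]pdE//; congr row_mx.
by rewrite /pd derive_id.
Qed.

Lemma pd_tangentE i j x :
  pd i (pd j (graph_map u)) x = row_mx 0 (\row_al dpart i (dpart j (rowc u al)) x).
Proof.
have -> : pd j (graph_map u) = fun y => row_mx (cst (evec R j) y) ((fun z => \row_al dpart j (rowc u al) z) y).
  by apply/funext => y; exact: tangentE.
have E al : rowc (fun z => \row_al dpart j (rowc u al) z) al = dpart j (rowc u al).
  by apply/funext => y; rewrite /rowc mxE.
have dE al y : differentiable (rowc (fun z => \row_al dpart j (rowc u al) z) al) y.
  by rewrite E; exact: Cdiff_differentiable (Cdiff_dpartu 0 j al).
rewrite (@pd_row_mx _ _ i (cst (evec R j)))//; last by move=> c; exact: differentiable_cst.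
congr row_mx; first by rewrite /pd derive_cst.
by rewrite pdE//; apply/rowP => al; rewrite !mxE E.
Qed.

Lemma metricE x : metric u x = gmx x.
Proof.
apply/matrixP => i j; rewrite mxE !tangentE dotv_row_mx dotv_evecl !mxE eqxx /= eq_sym.
congr (_ + _); rewrite dotvE; apply: eq_bigr => al _.
by rewrite !mxE.
Qed.

Lemma tangent_normal i al x : dotv (tangent u i x) (normalv al x) = 0.
Proof.
rewrite tangentE /normalv dotv_row_mx dotv_evecl dotvC dotv_evecl !mxE.
exact: addNr.
Qed.

Lemma tproj_normal v al x : dotv (tproj u x v) (normalv al x) = 0.
Proof.
rewrite /tproj dotv_suml big1// => i _; rewrite dotv_suml big1// => j _.
by rewrite dotvZl tangent_normal mulr0.
Qed.

(** Pairing with the normal frame erases the tangential projection, so the geometric equations can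
    be read off without computing it. *)
Lemma nproj_normal v al x : dotv (nproj u x v) (normalv al x) = dotv v (normalv al x).
Proof. by rewrite /nproj dotvBl tproj_normal subr0. Qed.

(** Pairing the shrinker equation with [normalv al] gives the trace of [S] against the Hessian on
    the left and [-(u - x . Du) / 2] on the right; the gradient term moves over to become the
    drift. *)
Lemma self_shrinker_driftlap al x : self_shrinker u ->
  driftlap Smx (rowc u al) x = - 2^-1 * rowc u al x.
Proof.
move=> /(_ x)/(congr1 (fun v => dotv v (normalv al x))).
rewrite dotvZl nproj_normal /mean_curv dotv_suml.
have -> : \sum_i dotv (\sum_j metric_inv u x i j *: nproj u x (pd i (pd j (graph_map u)) x)) (normalv al x)
   = hessS Smx (rowc u al) x.
  rewrite /hessS; apply: eq_bigr => i _; rewrite dotv_suml; apply: eq_bigr => j _.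
  rewrite dotvZl nproj_normal /metric_inv metricE pd_tangentE /normalv dotv_row_mx dotv0l add0r.
  by rewrite dotvC dotv_evecl mxE.
have -> : dotv (graph_map u x) (normalv al x) = - (\sum_k x 0 k * dpart k (rowc u al) x) + rowc u al x.
  rewrite /graph_map /normalv dotv_row_mx; congr (_ + _); last by rewrite dotvC dotv_evecl.
  by rewrite dotvC dotvNl dotvC dotvE; congr (- _); apply: eq_bigr => k _; rewrite mxE.
rewrite /driftlap => ->; move: (\sum_k _) (rowc _ _ _) => a b; ring.
Qed.

Lemma Cdiff_normalv N al a : Cdiff N (rowc (normalv al) a).
Proof.
case: (split_ordP a) => b ->.
  apply: (@Cdiff_ext _ _ _ (fun x => - dpart b (rowc u al) x)) => [x|].
    by rewrite /rowc /normalv row_mxEl !mxE.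
  by apply: CdiffN; exact: Cdiff_dpartu.
by apply: Cdiff_ext (Cdiff_cst N (evec R al 0 b)) => x; rewrite /rowc /normalv row_mxEr.
Qed.

Lemma pd_normalv i al x :
  pd i (normalv al) x = row_mx (- \row_k dpart i (dpart k (rowc u al)) x) 0.
Proof.
have dk k y : differentiable (dpart k (rowc u al)) y.
  exact: Cdiff_differentiable (Cdiff_dpartu 0 k al).
have E k : rowc (fun y => - \row_k dpart k (rowc u al) y) k = fun y => - dpart k (rowc u al) y.
  by apply/funext => y; rewrite /rowc !mxE.
have dE k y : differentiable (rowc (fun y => - \row_k dpart k (rowc u al) y) k) y.
  by rewrite E; exact/differentiableN.
rewrite /normalv (@pd_row_mx _ _ i _ (cst (evec R al)))//; last by move=> c; exact: differentiable_cst.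
congr row_mx; last by rewrite /pd derive_cst.
by rewrite pdE//; apply/rowP => k; rewrite !mxE E dpartN.
Qed.

Lemma pd_normalv_tangent i j al x :
  dotv (pd i (normalv al) x) (tangent u j x) = - hess al x i j.
Proof.
by rewrite pd_normalv tangentE dotv_row_mx dotv0l addr0 dotvC dotv_evecl !mxE.
Qed.

Lemma Cdiff_pd_normalv N i al a : Cdiff N (rowc (pd i (normalv al)) a).
Proof.
by rewrite rowc_pd => [|*]; [apply: Cdiff_dpart|]; exact: Cdiff_normalv.
Qed.

Lemma Cdiff_tangent N i a : Cdiff N (rowc (tangent u i) a).
Proof.
case: (split_ordP a) => b ->.
  by apply: Cdiff_ext (Cdiff_cst N (evec R i 0 b)) => x; rewrite /rowc tangentE row_mxEl.
apply: Cdiff_ext (Cdiff_dpartu N i b) => x.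
by rewrite /rowc tangentE row_mxEr mxE.
Qed.

Lemma Cdiff_nabla_perp N i al a : Cdiff N (rowc (nabla_perp u i (normalv al)) a).
Proof.
apply: (@Cdiff_ext _ _ _ (fun x => rowc (pd i (normalv al)) a x -
   \sum_k \sum_l Smx x k l * dotv (pd i (normalv al) x) (tangent u l x) * rowc (tangent u k) a x)).
  move=> x; rewrite /rowc /nabla_perp /nproj /tproj [RHS]mxE; congr (_ + _).
  rewrite [RHS]mxE summxE; congr (- _); apply: eq_bigr => k _; rewrite summxE.
  by apply: eq_bigr => l _; rewrite [RHS]mxE /metric_inv metricE.
apply: CdiffB; first exact: Cdiff_pd_normalv.
apply: Cdiff_sum => k; apply: Cdiff_sum => l; apply: CdiffM; last exact: Cdiff_tangent.
apply: CdiffM; first exact: Cdiff_Smx.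
by apply: Cdiff_dotv => b; [exact: Cdiff_pd_normalv|exact: Cdiff_tangent].
Qed.

(** Differentiate the identity saying that [nabla_perp u j (normalv be)] and [pd j (normalv be)]
    have the same product with [normalv al]. The two product rules differ by the pairing of the
    tangential part with [pd i (normalv al)], which is the Hessian product. *)
Lemma nabla_perp2_normal i j al be x :
  dotv (nabla_perp u i (nabla_perp u j (normalv be)) x) (normalv al x) =
  dotv (pd i (pd j (normalv be)) x) (normalv al x) + (hess al x *m Smx x *m hess be x) i j.
Proof.
rewrite {1}/nabla_perp nproj_normal.
have := dpart_dotv i x (Cdiff_nabla_perp 0 j be) (Cdiff_normalv 0 al).
have -> : (fun y => dotv (nabla_perp u j (normalv be) y) (normalv al y)) =
    fun y => dotv (pd j (normalv be) y) (normalv al y).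
  by apply/funext => y; rewrite /nabla_perp nproj_normal.
rewrite (dpart_dotv i x (Cdiff_pd_normalv 0 j be) (Cdiff_normalv 0 al)).
rewrite {2}/nabla_perp {1}/nproj dotvBl.
have -> : dotv (tproj u x (pd j (normalv be) x)) (pd i (normalv al) x) =
    (hess al x *m Smx x *m hess be x) i j.
  rewrite /tproj dotv_suml [RHS]mxE.
  transitivity (\sum_k \sum_l hess al x i k * Smx x k l * hess be x l j); last first.
    by rewrite exchange_big /=; apply: eq_bigr => l _; rewrite [X in _ = X * _]mxE mulr_suml.
  apply: eq_bigr => k _; rewrite dotv_suml; apply: eq_bigr => l _.
  rewrite dotvZl pd_normalv_tangent dotvC pd_normalv_tangent /metric_inv metricE.
  have -> : hess be x j l = hess be x l j by rewrite -[in LHS](hess_sym be) [LHS]mxE.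
  rewrite -/(Smx x).
  move: (Smx x k l) (hess _ _ _ _) (hess _ _ _ _) => a b c; ring.
by move: (dotv _ _) (dotv _ _) (dotv _ _) ((_ *m _) i j) => a b c d; lra.
Qed.

(** Flatness is tested on the frame field [normalv be]. The pure second derivatives are symmetric in
    [i], [j] and cancel, so [U_al S U_be] is a symmetric matrix; its transpose is [U_be S U_al]. *)
Lemma flat_hess_comm al be x : flat_normal_bundle u ->
  hess al x *m Smx x *m hess be x = hess be x *m Smx x *m hess al x.
Proof.
move=> flat; apply/matrixP => i j.
have nf : normal_field u (normalv be).
  split; first by apply: Cdiff_smooth => N a; exact: Cdiff_normalv.
  by move=> y k; rewrite dotvC tangent_normal.
have E k k' : pd k (pd k' (normalv be)) x = \row_a dpart k (dpart k' (rowc (normalv be) a)) x.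
  rewrite pdE => [|a]; last exact: Cdiff_differentiable (Cdiff_pd_normalv 0 k' be a).
  by apply/rowP => a; rewrite !mxE rowc_pd// => *; exact: Cdiff_normalv.
have Epd : pd i (pd j (normalv be)) x = pd j (pd i (normalv be)) x.
  by rewrite !E; apply/rowP => a; rewrite !mxE; apply: dpartC; exact: Cdiff_normalv.
have := nabla_perp2_normal j i al be x.
rewrite -(flat _ nf i j x) (nabla_perp2_normal i j al be x) Epd => /addrI ->.
transitivity ((hess al x *m Smx x *m hess be x)^T i j); first by rewrite [RHS]mxE.
by rewrite !trmx_mul !hess_sym Smx_sym mulmxA.
Qed.

End GraphGeometry.

(** * Pointwise linear algebra of the second fundamental form *)

Section CurvatureAlgebra.
Context {R : realType} {n m : nat}.
Variables (S : 'M[R]_n) (D : 'M[R]_(n, m)) (U : 'I_m -> 'M[R]_n).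
Hypothesis S_sym : S^T = S.
Hypothesis U_sym : forall al, (U al)^T = U al.
Implicit Types (k l : 'I_n) (al be : 'I_m).

(** At a point of the graph, [V k] is the derivative of [D] in direction [k] and [G k] that of the
    metric. When [S] is the inverse metric, [1 - P] is the inverse of [1 + D^T D], the Gram matrix
    of the normal frame. *)
Let E : 'M[R]_(n, m) := S *m D.
Let P : 'M[R]_m := D^T *m S *m D.
Let V k : 'M[R]_(n, m) := \matrix_(a, be) U be a k.
Let G k : 'M[R]_n := V k *m D^T + D *m (V k)^T.

Let trE : E^T = D^T *m S. Proof. by rewrite /E trmx_mul S_sym. Qed.

Let mulmxV_entry (p : nat) (A : 'M[R]_(p, n)) k a be : (A *m V k) a be = (A *m U be) a k.
Proof. by rewrite !mxE; apply: eq_bigr => b _; rewrite mxE. Qed.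

Let VAV_entry (A : 'M[R]_n) k l al be :
  ((V l)^T *m A *m V k) al be = (U al *m A *m U be) l k.
Proof.
rewrite mulmxV_entry mxE [RHS]mxE; apply: eq_bigr => a _; congr (_ * _).
rewrite mxE [RHS]mxE; apply: eq_bigr => b _; congr (_ * _).
by rewrite !mxE -{1}(U_sym al) mxE.
Qed.

Lemma sum_bilin (p q : nat) (A : 'M[R]_(p, n)) (B : 'M[R]_(n, q)) a b :
  \sum_k \sum_l S k l * (A a k * B l b) = (A *m S *m B) a b.
Proof.
rewrite mxE exchange_big /=; apply: eq_bigr => l _; rewrite mxE mulr_suml.
by apply: eq_bigr => k _; rewrite mulrA [S k l * _]mulrC.
Qed.

(** The two summands of [G k] are transposes of each other, so they have the same trace against the
    symmetric [S]. *)
Lemma trace_dmetric k : \tr (S *m G k) = 2 * \sum_al (E^T *m U al) al k.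
Proof.
have -> : \tr (S *m G k) = \tr (E^T *m V k) + \tr (E^T *m V k).
  rewrite /G mulmxDr mxtraceD; congr (_ + _).
    by rewrite mulmxA mxtrace_mulC mulmxA trE.
  by rewrite -mxtrace_tr !trmx_mul trmxK S_sym -mulmxA mxtrace_mulC ?trE.
rewrite mulrDl mul1r; congr (_ + _); apply: eq_bigr => al _; exact: mulmxV_entry.
Qed.

Lemma trace_dmetric_hess k al :
  \tr (S *m G k *m S *m U al) = 2 * \sum_be (E^T *m U al *m S *m U be) be k.
Proof.
have -> : \tr (S *m G k *m S *m U al) =
    \tr (E^T *m U al *m S *m V k) + \tr (E^T *m U al *m S *m V k).
  rewrite /G mulmxDr !mulmxDl mxtraceD; congr (_ + _).
    rewrite trE mulmxA -3!mulmxA mxtrace_mulC -!mulmxA.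
    by rewrite mxtrace_mulC !mulmxA.
  rewrite -mxtrace_tr !trmx_mul trmxK S_sym U_sym ?trE -!mulmxA.
  by do 3 rewrite [in LHS]mxtrace_mulC -!mulmxA.
rewrite mulrDl mul1r; congr (_ + _); apply: eq_bigr => be _; exact: mulmxV_entry.
Qed.

(** This sum arises from the squared gradient of the log-determinant and [crossC] from its drift
    Laplacian. They differ only in the order of the two Hessians. *)
Definition cross : R := \sum_al \sum_be (E^T *m U al *m S *m U be *m E) al be.

Definition crossC : R := \sum_al \sum_be (E^T *m U be *m S *m U al *m E) al be.

(** The squared norm of the second fundamental form: its components in the normal frame are the
    [U al], [S] raises tangential indices and [1 - P] the normal ones. *)
Definition normB : R :=
  \sum_al \sum_be ((1%:M - P) al be * \tr (S *m U al *m S *m U be)).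

Lemma trace_dmetric2 k l : \tr (S *m G k *m S *m G l) =
  2 * \sum_al \sum_be ((E^T *m U be) al k * (E^T *m U al) be l)
  + 2 * \sum_al \sum_be (P al be * (U al *m S *m U be) l k).
Proof.
(* The product of [G k] and [G l] expands into four traces. Transposition and cyclicity reduce the
   two unmixed ones to [T1] and the two mixed ones to [T2]. *)
pose T1 := \tr (E^T *m V k *m (E^T *m V l)); pose T2 := \tr (P *m ((V l)^T *m S *m V k)).
have PT : P^T = P by rewrite /P !trmx_mul trmxK S_sym mulmxA.
have -> : \tr (S *m G k *m S *m G l) = 2 * T1 + 2 * T2.
  rewrite /G !(mulmxDr, mulmxDl) !mxtraceD.
  have -> : \tr (S *m (V k *m D^T) *m S *m (V l *m D^T)) = T1.
    by rewrite /T1 trE -!mulmxA [in RHS]mxtrace_mulC -!mulmxA.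
  have -> : \tr (S *m (D *m (V k)^T) *m S *m (D *m (V l)^T)) = T1.
    rewrite -mxtrace_tr !trmx_mul !trmxK S_sym /T1 ?trE -!mulmxA.
    by rewrite [in LHS]mxtrace_mulC -!mulmxA.
  have -> : \tr (S *m (V k *m D^T) *m S *m (D *m (V l)^T)) = T2.
    rewrite /T2 /P -!mulmxA.
    by do 2 rewrite [in LHS]mxtrace_mulC -!mulmxA.
  have -> : \tr (S *m (D *m (V k)^T) *m S *m (V l *m D^T)) = T2.
    rewrite -mxtrace_tr !trmx_mul !trmxK S_sym /T2 /P -!mulmxA.
    by do 2 rewrite [in RHS]mxtrace_mulC -!mulmxA.
  by move: T1 T2 => a b; ring.
congr (2 * _ + 2 * _).
  apply: eq_bigr => al _; rewrite mxE; apply: eq_bigr => be _.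
  by rewrite !mulmxV_entry.
rewrite /T2 mxtrace_mulC.
transitivity (\sum_al \sum_be ((U al *m S *m U be) l k * P be al)).
  by apply: eq_bigr => al _; rewrite mxE; apply: eq_bigr => be _; rewrite VAV_entry.
apply: eq_bigr => al _; apply: eq_bigr => be _.
by rewrite mulrC -[in LHS]PT [P^T _ _]mxE.
Qed.

Lemma sum_trace_dmetric2 :
  \sum_k \sum_l S k l * \tr (S *m G k *m S *m G l) =
  2 * crossC + 2 * \sum_al \sum_be (P al be * \tr (S *m U al *m S *m U be)).
Proof.
have -> : crossC = \sum_k \sum_l S k l *
    \sum_al \sum_be ((E^T *m U be) al k * (E^T *m U al) be l).
  transitivity (\sum_al \sum_be \sum_k \sum_l S k l * ((E^T *m U be) al k * (U al *m E) l be)).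
    by apply: eq_bigr => al _; apply: eq_bigr => be _; rewrite sum_bilin !mulmxA.
  transitivity (\sum_k \sum_l \sum_al \sum_be S k l * ((E^T *m U be) al k * (U al *m E) l be)).
    under eq_bigr do rewrite exchange_big /=.
    rewrite exchange_big /=; apply: eq_bigr => k _.
    under eq_bigr do rewrite exchange_big /=.
    by rewrite exchange_big.
  apply: eq_bigr => k _; apply: eq_bigr => l _; rewrite mulr_sumr; apply: eq_bigr => al _.
  rewrite mulr_sumr; apply: eq_bigr => be _; congr (_ * (_ * _)).
  by rewrite -(U_sym al) -[E in LHS]trmxK -trmx_mul [LHS]mxE U_sym.
have -> : \sum_al \sum_be (P al be * \tr (S *m U al *m S *m U be)) =
    \sum_k \sum_l S k l * \sum_al \sum_be (P al be * (U al *m S *m U be) l k).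
  transitivity (\sum_al \sum_be \sum_k \sum_l S k l * (P al be * (U al *m S *m U be) l k)).
    apply: eq_bigr => al _; apply: eq_bigr => be _.
    rewrite -2!mulmxA /mxtrace mulr_sumr; apply: eq_bigr => k _.
    by rewrite [(S *m _) k k]mxE mulr_sumr; apply: eq_bigr => l _; rewrite mulrCA mulmxA.
  transitivity (\sum_k \sum_l \sum_al \sum_be S k l * (P al be * (U al *m S *m U be) l k)).
    under eq_bigr do rewrite exchange_big /=.
    rewrite exchange_big /=; apply: eq_bigr => k _.
    under eq_bigr do rewrite exchange_big /=.
    by rewrite exchange_big.
  apply: eq_bigr => k _; apply: eq_bigr => l _; rewrite mulr_sumr; apply: eq_bigr => al _.
  by rewrite mulr_sumr.
rewrite !mulr_sumr -big_split /=; apply: eq_bigr => k _.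
rewrite !mulr_sumr -big_split /=; apply: eq_bigr => l _.
rewrite trace_dmetric2; move: (S k l) (\sum_al _) (\sum_al _) => a b c; ring.
Qed.

Lemma sum_trace_hess :
  \sum_al \tr (S *m (U al *m S *m U al)) - \sum_al \sum_be (P al be * \tr (S *m U al *m S *m U be))
  = normB.
Proof.
rewrite /normB -sumrB; apply: eq_bigr => al _.
have -> : \tr (S *m (U al *m S *m U al)) =
    \sum_be ((1%:M : 'M[R]_m) al be * \tr (S *m U al *m S *m U be)).
  rewrite (bigD1 al)//= mxE eqxx mul1r big1 ?addr0 ?mulmxA// => be /negbTE ba.
  by rewrite mxE eq_sym ba mul0r.
rewrite -sumrB; apply: eq_bigr => be _.
rewrite [((1%:M - P)%R) _ _]mxE [(- P)%R _ _]mxE; ring.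
Qed.

Section Positivity.
Hypothesis SgS : S *m (1%:M + D *m D^T) = 1%:M.

(** [S = S g S] with [g = 1 + D D^T] gives [S = S S^T + E E^T]. *)
Let S_gram_eq : S = row_mx S E *m (row_mx S E)^T.
Proof.
rewrite tr_row_mx mul_row_col S_sym trE.
have : S *m (1%:M + D *m D^T) *m S = S by rewrite SgS mul1mx.
by rewrite mulmxDr mulmx1 mulmxDl !mulmxA => {1}<-.
Qed.

Lemma inv_metric_gram : exists p (Y : 'M[R]_(n, p)), S = Y *m Y^T.
Proof. by exists (n + m)%N, (row_mx S E); exact: S_gram_eq. Qed.

Let DSDD : D^T *m S *m D *m D^T = D^T - D^T *m S.
Proof.
by rewrite -[X in _ = X - _]mulmx1 -SgS mulmxDr mulmx1 mulmxDr addrC addKr !mulmxA.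
Qed.

(** From [D^T S D D^T = D^T - D^T S] one gets [P^2 = P - E^T E], hence
    [(1 - P)^2 + E^T E = 1 - P]. *)
Let N_gram : 1%:M - P = row_mx (1%:M - P) E^T *m (row_mx (1%:M - P) E^T)^T.
Proof.
rewrite tr_row_mx mul_row_col trmxK linearB /= trmx1.
have -> : P^T = P by rewrite /P !trmx_mul trmxK S_sym mulmxA.
rewrite mulmxBl mul1mx mulmxBr mulmx1.
have -> : P *m P = P - E^T *m E.
  rewrite {1 2}/P mulmxA [_ *m D *m (D^T *m S)]mulmxA DSDD trE /E mulmxBl mulmxBl.
  by rewrite /P !mulmxA.
by rewrite subKr subrK.
Qed.

Let sumsq_ge0 (p q : nat) (A : 'M[R]_(p, q)) : 0 <= \tr (A *m A^T).
Proof.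
apply: sumr_ge0 => a _; rewrite mxE; apply: sumr_ge0 => b _; rewrite mxE -expr2; exact: sqr_ge0.
Qed.

Let sumsq_eq0 (p q : nat) (A : 'M[R]_(p, q)) : \tr (A *m A^T) = 0 -> A = 0.
Proof.
move=> /eqP; rewrite psumr_eq0 => [/allP A0|a _]; last first.
  by rewrite mxE; apply: sumr_ge0 => b _; rewrite mxE -expr2; exact: sqr_ge0.
apply/matrixP => a b; have := A0 a; rewrite mem_index_enum /= mxE => /(_ isT).
rewrite psumr_eq0 => [/allP/(_ b)|c _]; last by rewrite mxE -expr2; exact: sqr_ge0.
by rewrite mem_index_enum /= !mxE -expr2 sqrf_eq0 => /(_ isT)/eqP.
Qed.

(** Contracting the Hessians with the columns of the Gram factor of [1 - P] diagonalizes the normal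
    indices: [normB] becomes the sum over [p] of [tr (S W_p S W_p)], and the Gram factor of [S] then
    makes each term a sum of squares. *)
Let W (p : 'I_(m + n)) : 'M[R]_n := \sum_al row_mx (1%:M - P) E^T al p *: U al.

Let W_sym p : (W p)^T = W p.
Proof.
by rewrite /W linear_sum /=; apply: eq_bigr => al _; rewrite linearZ /= U_sym.
Qed.

Let YWY p := (row_mx S E)^T *m W p *m row_mx S E.

Let trace_gram (p q : nat) (Y : 'M[R]_(p, q)) (A : 'M[R]_p) : A^T = A ->
  \tr (Y *m Y^T *m A *m (Y *m Y^T) *m A) = \tr (Y^T *m A *m Y *m (Y^T *m A *m Y)^T).
Proof. by move=> AT; rewrite !trmx_mul trmxK AT -!mulmxA [in LHS]mxtrace_mulC -!mulmxA. Qed.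

Let normB_sumsq : normB = \sum_p \tr (YWY p *m (YWY p)^T).
Proof.
transitivity (\sum_p \tr (S *m W p *m S *m W p)); last first.
  apply: eq_bigr => p _.
  by apply: etrans (trace_gram (row_mx S E) (W_sym p)); rewrite -S_gram_eq.
transitivity (\sum_p \sum_al \sum_be row_mx (1%:M - P) E^T al p *
    (row_mx (1%:M - P) E^T be p * \tr (S *m U al *m S *m U be))); last first.
  apply: eq_bigr => p _.
  have linl (B : 'M[R]_n) : \tr (S *m W p *m S *m B) =
      \sum_al row_mx (1%:M - P) E^T al p * \tr (S *m U al *m S *m B).
    rewrite /W mulmx_sumr !mulmx_suml linear_sum /=; apply: eq_bigr => al _.
    by rewrite -scalemxAr -!scalemxAl mxtraceZ.
  have linr (A : 'M[R]_n) : \tr (A *m W p) = \sum_be row_mx (1%:M - P) E^T be p * \tr (A *m U be).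
    by rewrite /W mulmx_sumr linear_sum /=; apply: eq_bigr => be _; rewrite -scalemxAr mxtraceZ.
  by rewrite linl; apply: eq_bigr => al _; rewrite linr mulr_sumr.
rewrite exchange_big /=; apply: eq_bigr => al _; rewrite exchange_big /=; apply: eq_bigr => be _.
rewrite [in LHS]N_gram mxE mulr_suml; apply: eq_bigr => p _.
by rewrite [(row_mx _ _)^T _ _]mxE mulrA.
Qed.

Lemma normB_ge0 : 0 <= normB.
Proof. by rewrite normB_sumsq; apply: sumr_ge0 => p _; exact: sumsq_ge0. Qed.

(** Each [S W_p S] vanishes, hence each [W_p], as [S] is invertible. The first [m] of them are the
    combinations of the [U al] with coefficients [1 - P], and [1 + D^T D] inverts these
    combinations. *)
Lemma normB_eq0 : normB = 0 -> forall al, U al = 0.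
Proof.
rewrite normB_sumsq => /eqP; rewrite psumr_eq0 => [/allP W0 be|p _]; last exact: sumsq_ge0.
have {}W0 p : W p = 0.
  have := W0 p; rewrite mem_index_enum => /(_ isT)/eqP/sumsq_eq0 YWY0.
  have SWS : S *m W p *m S = 0.
    transitivity (row_mx S E *m YWY p *m (row_mx S E)^T); last by rewrite YWY0 mulmx0 mul0mx.
    by rewrite {1 2}S_gram_eq /YWY !mulmxA.
  have gS : (1%:M + D *m D^T) *m S = 1%:M.
    by apply: trmx_inj; rewrite trmx_mul S_sym linearD /= !trmx1 trmx_mul trmxK SgS.
  transitivity ((1%:M + D *m D^T) *m (S *m W p *m S) *m (1%:M + D *m D^T)).
    by rewrite !mulmxA gS mul1mx -mulmxA SgS mulmx1.
  by rewrite SWS mulmx0 mul0mx.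
have NN : (1%:M - P) *m (1%:M + D^T *m D) = 1%:M.
  rewrite mulmxDr mulmx1 mulmxBl mul1mx /P mulmxA DSDD mulmxBl.
  by rewrite opprB [_ + (_ - _)]addrC subrK subrK.
have -> : U be = \sum_ga (1%:M + D^T *m D) ga be *: W (lshift n ga).
  transitivity (\sum_al (1%:M : 'M[R]_m) al be *: U al).
    rewrite (bigD1 be)//= mxE eqxx scale1r big1 ?addr0// => al /negbTE ab.
    by rewrite mxE ab scale0r.
  have Wexp ga : (1%:M + D^T *m D) ga be *: W (lshift n ga) =
      \sum_al ((1%:M + D^T *m D) ga be * (1%:M - P) al ga) *: U al.
    by rewrite /W scaler_sumr; apply: eq_bigr => al _; rewrite row_mxEl scalerA.
  rewrite [RHS](eq_bigr _ (fun ga _ => Wexp ga)) exchange_big /= -[in LHS]NN.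
  apply: eq_bigr => al _; rewrite [in LHS]mxE scaler_suml.
  by apply: eq_bigr => ga _; rewrite mulrC.
by apply: big1 => ga _; rewrite W0 scaler0.
Qed.

Lemma inv_metric_pos (v : 'rV[R]_n) : v != 0 -> 0 < \sum_k \sum_l v 0 k * v 0 l * S k l.
Proof.
move=> v0; have -> : \sum_k \sum_l v 0 k * v 0 l * S k l = \tr (v *m row_mx S E *m (v *m row_mx S E)^T).
  rewrite trmx_mul mulmxA -(mulmxA v) -S_gram_eq /mxtrace big_ord1 -sum_bilin.
  by apply: eq_bigr => k _; apply: eq_bigr => l _; rewrite [v^T _ _]mxE mulrC.
rewrite lt_neqAle sumsq_ge0 andbT eq_sym; apply: contra v0 => /eqP/sumsq_eq0 vY.
have vS : v *m S = 0 by rewrite S_gram_eq mulmxA vY mul0mx.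
by rewrite -[v]mulmx1 -SgS mulmxA vS mul0mx.
Qed.

(** The diagonal of [S = S S^T + E E^T] gives [S_kk ^+ 2 <= S_kk], so each diagonal entry is at most
    1. *)
Lemma inv_metric_trace : \tr S <= n%:R.
Proof.
rewrite -[leRHS](_ : \sum_(k < n) 1 = _); last by rewrite sumr_const card_ord.
apply: ler_sum => k _.
have : S k k ^+ 2 <= S k k.
  rewrite [leRHS](_ : _ = (S *m S^T) k k + (E *m E^T) k k); last first.
    by rewrite {1}S_gram_eq tr_row_mx mul_row_col mxE.
  have -> : (S *m S^T) k k = S k k ^+ 2 + \sum_(l | l != k) S k l ^+ 2.
    by rewrite mxE (bigD1 k)//= mxE expr2; congr (_ + _); apply: eq_bigr => l _; rewrite mxE expr2.
  rewrite -addrA lerDl addr_ge0//; first by apply: sumr_ge0 => l _; exact: sqr_ge0.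
  by rewrite mxE; apply: sumr_ge0 => al _; rewrite [E^T _ _]mxE -expr2 sqr_ge0.
move: (S k k) => s; nra.
Qed.

End Positivity.

End CurvatureAlgebra.

(** * The drift Laplacian of the log-determinant on a self-shrinker *)

Section ShrinkerEquation.
Context {R : realType} {n m : nat}.
Variable u : 'rV[R]_n -> 'rV[R]_m.
Hypothesis u_smooth : smooth u.
Hypothesis u_shrinker : self_shrinker u.
Implicit Types (i k l : 'I_n) (al be : 'I_m) (x y : 'rV[R]_n).

Local Notation uc := (rowc u).
Local Notation S := (Smx u).
Local Notation g := (gmx u).
Let Cuc N al : Cdiff N (uc al).
Proof. exact: smooth_Cdiff. Qed.
Let Cduc N i al : Cdiff N (dpart i (uc al)).
Proof. by apply: Cdiff_dpart; exact: Cuc. Qed.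
Let S_entry_sym x k l : S x k l = S x l k.
Proof. by rewrite -[in LHS](Smx_sym u x) mxE. Qed.

Lemma driftlap_sum (I : Type) (r : seq I) (F : I -> 'rV[R]_n -> R) x :
  (forall a, Cdiff 2 (F a)) ->
  driftlap S (fun y => \sum_(a <- r) F a y) x = \sum_(a <- r) driftlap S (F a) x.
Proof.
move=> CF; elim: r => [|a r IH].
  rewrite big_nil; transitivity (driftlap S (fun=> 0) x); last exact: driftlap_cst.
  by congr (driftlap S _ x); apply/funext => y; rewrite big_nil.
rewrite big_cons -IH -driftlapD//; last exact: Cdiff_sum.
by congr (driftlap S _ x); apply/funext => y; rewrite big_cons.
Qed.

(** Differentiate [L u = - u / 2] in direction [i]. The derivative of the coefficient [x_k] yields
    an extra [- dpart i u / 2], which cancels the right-hand side; what remains comes from the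
    derivative [- S (d_i g) S] of [S]. *)
Lemma driftlap_dpartu i al x :
  driftlap S (dpart i (uc al)) x = \tr (S x *m dpartmx i g x *m S x *m hess u al x).
Proof.
have E : driftlap S (uc al) = fun y => - 2^-1 * uc al y.
  by apply/funext => y; exact: self_shrinker_driftlap.
have := congr1 (fun F => dpart i F x) E; rewrite (dpartZ i _ (Cdiff_differentiable x (Cuc 0 al))).
have CS k l := Cdiff_Smx u_smooth 0 k l.
have dS k l y : differentiable (fun z => S z k l) y := Cdiff_differentiable y (CS k l).
have C2 k l : Cdiff 0 (dpart k (dpart l (uc al))) by apply: Cdiff_dpart; exact: Cduc.
have d2 k l y := Cdiff_differentiable y (C2 k l).
have d1 k y := Cdiff_differentiable y (Cduc 0 k al).
have CH k l : Cdiff 0 (fun y => S y k l * dpart k (dpart l (uc al)) y) by exact: CdiffM.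
have CHs k : Cdiff 0 (fun y => \sum_l S y k l * dpart k (dpart l (uc al)) y) by exact: Cdiff_sum.
have CX k : Cdiff 0 (fun y => y 0 k * dpart k (uc al) y) by apply: CdiffM; [exact: Cdiff_coord|exact: Cduc].
have -> : dpart i (driftlap S (uc al)) x =
    \sum_k \sum_l (S x k l * dpart i (dpart k (dpart l (uc al))) x
                  + dpart k (dpart l (uc al)) x * dpart i (fun y => S y k l) x)
    - 2^-1 * (\sum_k x 0 k * dpart i (dpart k (uc al)) x + dpart i (uc al) x).
  transitivity (dpart i (fun y => hessS S (uc al) y + - (2^-1 * \sum_k y 0 k * dpart k (uc al) y)) x).
    by [].
  have CHH : Cdiff 0 (hessS S (uc al)) by exact: Cdiff_sum.
  have CXX : Cdiff 0 (fun y => \sum_k y 0 k * dpart k (uc al) y) by exact: Cdiff_sum.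
  have CZX := CdiffZ 2^-1 CXX.
  rewrite (dpartD i (Cdiff_differentiable x CHH) (Cdiff_differentiable x (CdiffN CZX))).
  rewrite (dpartN i (Cdiff_differentiable x CZX)) (dpartZ i _ (Cdiff_differentiable x CXX)).
  congr (_ - _ * _).
    rewrite /hessS dpart_sum => [|k y]; last exact: Cdiff_differentiable (CHs k).
    apply: eq_bigr => k _; rewrite dpart_sum => [|l y]; last exact: Cdiff_differentiable (CH k l).
    by apply: eq_bigr => l _; rewrite (dpartM i (dS k l x) (d2 k l x)).
  rewrite dpart_sum => [|k y]; last exact: Cdiff_differentiable (CX k).
  rewrite [X in _ = _ + X](_ : _ = \sum_k dpart k (uc al) x * (i == k)%:R); last first.
    rewrite (bigD1 i)//= eqxx mulr1 big1 ?addr0// => k /negbTE ki.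
    by rewrite eq_sym ki mulr0.
  rewrite -big_split /=; apply: eq_bigr => k _.
  by rewrite (dpartM i (differentiable_coord x 0 k) (d1 k x)) dpart_coord.
have -> : \sum_k \sum_l (S x k l * dpart i (dpart k (dpart l (uc al))) x
                  + dpart k (dpart l (uc al)) x * dpart i (fun y => S y k l) x) =
   hessS S (dpart i (uc al)) x - \tr (S x *m dpartmx i g x *m S x *m hess u al x).
  rewrite /hessS /mxtrace -sumrB; apply: eq_bigr => k _.
  rewrite [X in _ = _ - X]mxE -sumrB; apply: eq_bigr => l _; congr (_ + _).
    congr (_ * _); rewrite dpartC; last exact: Cduc.
    congr (dpart k _ x); apply/funext => y; apply: dpartC; exact: Cuc.
  have -> : dpart i (fun y => S y k l) x = dpartmx i S x k l by rewrite mxE.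
  rewrite /Smx (dpartmx_inv i x (gmx_unit u) (Cdiff_gmx u_smooth 0)).
  rewrite [X in _ * X = _]mxE mulrN mulrC; congr (- (_ * _)).
  by rewrite -(hess_sym u_smooth) !mxE.
have -> : \sum_k x 0 k * dpart i (dpart k (uc al)) x = \sum_k x 0 k * dpart k (dpart i (uc al)) x.
  by apply: eq_bigr => k _; rewrite dpartC.
rewrite /driftlap; move: (hessS _ _ _) (\tr _) (\sum_k _) (dpart i (uc al) x) => a b c d.
lra.
Qed.

Lemma dpartmx_gmx k x : dpartmx k g x =
  (\matrix_(a, be) hess u be x a k) *m (grad u x)^T + grad u x *m (\matrix_(a, be) hess u be x a k)^T.
Proof.
have CD := Cdiff_grad u_smooth 0.
have CDT : Cdiffmx 0 (fun y => (grad u y)^T).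
  by move=> be a; apply: Cdiff_ext (CD a be) => y; rewrite [RHS]mxE.
have dD : dpartmx k (grad u) x = \matrix_(a, be) hess u be x a k.
  apply/matrixP => a be; rewrite !mxE dpartC//.
  by congr (dpart k _ x); apply/funext => y; rewrite mxE.
have dDT : dpartmx k (fun y => (grad u y)^T) x = (\matrix_(a, be) hess u be x a k)^T.
  rewrite -dD; apply/matrixP => be a; rewrite !mxE.
  by congr (dpart k _ x); apply/funext => y; rewrite mxE.
have CDD := Cdiffmx_mul CD CDT.
rewrite -dDT -dD -(dpartmx_mul k x CD CDT); apply/matrixP => a b; rewrite !mxE.
transitivity (dpart k (fun y => (1%:M : 'M[R]_n) a b + (grad u y *m (grad u y)^T) a b) x).
  by congr (dpart k _ x); apply/funext => y; rewrite [LHS]mxE.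
rewrite (dpartD k (differentiable_cst _ _) (Cdiff_differentiable x (CDD a b))).
by rewrite dpart_cst add0r.
Qed.

Lemma driftlap_gmx a b x : driftlap S (fun y => g y a b) x =
  \sum_al (dpart a (uc al) x * driftlap S (dpart b (uc al)) x
         + dpart b (uc al) x * driftlap S (dpart a (uc al)) x
         + 2 * (hess u al x *m S x *m hess u al x) a b).
Proof.
transitivity (driftlap S (fun y => (1%:M : 'M[R]_n) a b +
    \sum_al dpart a (uc al) y * dpart b (uc al) y) x).
  congr (driftlap S _ x); apply/funext => y; rewrite /gmx [LHS]mxE; congr (_ + _).
  by rewrite mxE; apply: eq_bigr => al _; rewrite !mxE.
have CM al : Cdiff 2 (fun y => dpart a (uc al) y * dpart b (uc al) y) by exact: CdiffM.
rewrite (driftlapD _ _ (Cdiff_cst 2 _)); last exact: Cdiff_sum.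
rewrite driftlap_cst add0r driftlap_sum//; apply: eq_bigr => al _.
rewrite (driftlapM S_entry_sym)//; congr (_ + _ * _).
rewrite -sum_bilin; apply: eq_bigr => k _; apply: eq_bigr => l _.
by rewrite [hess _ _ _ a k]mxE [hess _ _ _ l b]mxE (dpartC a k)//; exact: Cuc.
Qed.

Let Cg N : Cdiffmx N g. Proof. exact: Cdiff_gmx. Qed.

Lemma driftlap_lndet2 x : driftlap S (lndet2 g) x =
  2 * (\sum_a \sum_b S x a b * driftlap S (fun y => g y b a) x
     - \sum_k \sum_l S x k l * \tr (S x *m dpartmx k g x *m S x *m dpartmx l g x)).
Proof.
have E1 k l : dpart k (dpart l (lndet2 g)) x =
    2 * (\sum_a \sum_b S x a b * dpart k (dpart l (fun y => g y b a)) x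
        - \tr (S x *m dpartmx k g x *m S x *m dpartmx l g x)).
  rewrite (dpart2_lndet2 (gmx_unit u))//; congr (_ * (_ - _)).
  apply: eq_bigr => a _; rewrite mxE; apply: eq_bigr => b _; congr (_ * _).
  by rewrite mxE; congr (dpart k _ x); apply/funext => y; rewrite mxE.
have E2 k : dpart k (lndet2 g) x = 2 * \sum_a \sum_b S x a b * dpart k (fun y => g y b a) x.
  rewrite (dpart_lndet2 (gmx_unit u))//; congr (_ * _).
  by apply: eq_bigr => a _; rewrite mxE; apply: eq_bigr => b _; rewrite mxE.
have -> : \sum_a \sum_b S x a b * driftlap S (fun y => g y b a) x =
   \sum_k \sum_l S x k l * (\sum_a \sum_b S x a b * dpart k (dpart l (fun y => g y b a)) x)
   - 2^-1 * \sum_k x 0 k * (\sum_a \sum_b S x a b * dpart k (fun y => g y b a) x).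
  have -> : \sum_k \sum_l S x k l * (\sum_a \sum_b S x a b * dpart k (dpart l (fun y => g y b a)) x)
     = \sum_a \sum_b S x a b * hessS S (fun y => g y b a) x.
    transitivity (\sum_k \sum_l \sum_a \sum_b S x k l * (S x a b * dpart k (dpart l (fun y => g y b a)) x)).
      apply: eq_bigr => k _; apply: eq_bigr => l _; rewrite mulr_sumr; apply: eq_bigr => a _.
      by rewrite mulr_sumr.
    transitivity (\sum_a \sum_b \sum_k \sum_l S x k l * (S x a b * dpart k (dpart l (fun y => g y b a)) x)).
      under eq_bigr do rewrite exchange_big /=.
      rewrite exchange_big /=; apply: eq_bigr => a _.
      under eq_bigr do rewrite exchange_big /=.
      by rewrite exchange_big.
    apply: eq_bigr => a _; apply: eq_bigr => b _; rewrite /hessS mulr_sumr; apply: eq_bigr => k _.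
    by rewrite mulr_sumr; apply: eq_bigr => l _; rewrite mulrCA.
  have -> : \sum_k x 0 k * (\sum_a \sum_b S x a b * dpart k (fun y => g y b a) x)
     = \sum_a \sum_b S x a b * \sum_k x 0 k * dpart k (fun y => g y b a) x.
    transitivity (\sum_k \sum_a \sum_b S x a b * (x 0 k * dpart k (fun y => g y b a) x)).
      apply: eq_bigr => k _; rewrite mulr_sumr; apply: eq_bigr => a _; rewrite mulr_sumr.
      by apply: eq_bigr => b _; rewrite mulrCA.
    rewrite exchange_big /=; apply: eq_bigr => a _; rewrite exchange_big /=; apply: eq_bigr => b _.
    by rewrite mulr_sumr.
  rewrite mulr_sumr -sumrB; apply: eq_bigr => a _; rewrite mulr_sumr -sumrB; apply: eq_bigr => b _.
  by rewrite /driftlap mulrBr [2^-1 * (S x a b * _)]mulrCA.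
rewrite /driftlap /hessS.
have -> : \sum_k \sum_l S x k l * dpart k (dpart l (lndet2 g)) x =
  2 * (\sum_k \sum_l S x k l * (\sum_a \sum_b S x a b * dpart k (dpart l (fun y => g y b a)) x)
      - \sum_k \sum_l S x k l * \tr (S x *m dpartmx k g x *m S x *m dpartmx l g x)).
  rewrite -sumrB mulr_sumr; apply: eq_bigr => k _; rewrite -sumrB mulr_sumr; apply: eq_bigr => l _.
  by rewrite E1 mulrCA mulrBr.
have -> : \sum_k x 0 k * dpart k (lndet2 g) x =
   2 * \sum_k x 0 k * (\sum_a \sum_b S x a b * dpart k (fun y => g y b a) x).
  by rewrite mulr_sumr; apply: eq_bigr => k _; rewrite E2 mulrCA.
have reorder (a b c : R) : 2 * (a - b) - 2^-1 * (2 * c) = 2 * (a - 2^-1 * c - b) by ring.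
exact: reorder.
Qed.

(** [L g] contributes [4 crossC] and the varying inverse removes [2 crossC]; the outer factor 2
    leaves 4. The pure Hessian trace minus its contraction with [P] combines into [normB]. *)
Lemma driftlap_lndet2_normB x : driftlap S (lndet2 g) x =
  4 * crossC (S x) (grad u x) (fun al => hess u al x)
  + 4 * normB (S x) (grad u x) (fun al => hess u al x).
Proof.
set D := grad u x; pose U al := hess u al x.
have ST : (S x)^T = S x := Smx_sym u x.
have UT al : (U al)^T = U al := hess_sym u_smooth al x.
rewrite driftlap_lndet2.
have -> : \sum_k \sum_l S x k l * \tr (S x *m dpartmx k g x *m S x *m dpartmx l g x) =
  2 * crossC (S x) D U + 2 * \sum_al \sum_be ((D^T *m S x *m D) al be * \tr (S x *m U al *m S x *m U be)).
  rewrite -(sum_trace_dmetric2 D ST UT); apply: eq_bigr => k _; apply: eq_bigr => l _.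
  by rewrite !dpartmx_gmx.
have LD b al : driftlap S (dpart b (uc al)) x =
    2 * \sum_be ((S x *m D)^T *m U al *m S x *m U be) be b.
  by rewrite driftlap_dpartu dpartmx_gmx -(trace_dmetric_hess D ST UT).
have -> : \sum_a \sum_b S x a b * driftlap S (fun y => g y b a) x =
    4 * crossC (S x) D U + 2 * \sum_al \tr (S x *m (U al *m S x *m U al)).
  transitivity (\sum_al (2 * \sum_b (S x *m D) b al * driftlap S (dpart b (uc al)) x
        + 2 * \tr (S x *m (U al *m S x *m U al)))).
    under eq_bigr do under eq_bigr do rewrite driftlap_gmx mulr_sumr.
    under eq_bigr do rewrite exchange_big /=.
    rewrite exchange_big /=; apply: eq_bigr => al _.
    have -> : \tr (S x *m (U al *m S x *m U al)) = \sum_a \sum_b S x a b * (U al *m S x *m U al) b a.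
      by apply: eq_bigr => a _; rewrite [LHS]mxE.
    (* The two first-order terms in [L g_ab] have equal contraction with the symmetric [S]; [E1] and
       [E2] write that common value in both forms. *)
    have E1 : \sum_b (S x *m D) b al * driftlap S (dpart b (uc al)) x =
        \sum_a \sum_b S x a b * (dpart b (uc al) x * driftlap S (dpart a (uc al)) x).
      apply: eq_bigr => b _; rewrite mxE mulr_suml; apply: eq_bigr => a _.
      by rewrite mxE mulrA.
    have E2 : \sum_b (S x *m D) b al * driftlap S (dpart b (uc al)) x =
        \sum_a \sum_b S x a b * (dpart a (uc al) x * driftlap S (dpart b (uc al)) x).
      rewrite E1 exchange_big /=; apply: eq_bigr => a _; apply: eq_bigr => b _.
      by rewrite S_entry_sym.
    rewrite mulrDl mul1r {1}E1 E2 -!big_split /= [X in _ = _ + X]mulr_sumr -big_split /=.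
    apply: eq_bigr => a _; rewrite -!big_split /= mulr_sumr -big_split /=; apply: eq_bigr => b _.
    by rewrite /U; move: (driftlap _ _ _) (driftlap _ _ _) ((_ *m _) b a) => p q r; ring.
  rewrite big_split /= -!mulr_sumr; congr (_ + _).
  have -> : 4 * crossC (S x) D U = 2 * (2 * crossC (S x) D U) by ring.
  congr (_ * _).
  rewrite /crossC mulr_sumr.
  transitivity (\sum_al \sum_be 2 * ((S x *m D)^T *m U al *m S x *m U be *m (S x *m D)) be al).
    apply: eq_bigr => al _.
    transitivity (\sum_b \sum_be 2 * ((S x *m D) b al * ((S x *m D)^T *m U al *m S x *m U be) be b)).
      by apply: eq_bigr => b _; rewrite LD mulrCA !mulr_sumr.
    rewrite exchange_big /=; apply: eq_bigr => be _; rewrite -mulr_sumr; congr (_ * _).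
    by rewrite [RHS]mxE; apply: eq_bigr => b _; rewrite mulrC.
  rewrite exchange_big /=; apply: eq_bigr => al _; rewrite mulr_sumr; apply: eq_bigr => be _.
  by [].
rewrite -(sum_trace_hess (S x) D U).
have reorder (a b c : R) : 2 * (4 * a + 2 * b - (2 * a + 2 * c)) = 4 * a + 4 * (b - c) by ring.
exact: reorder.
Qed.

Lemma gradS_lndet2 x : gradS S (lndet2 g) (lndet2 g) x =
  16 * cross (S x) (grad u x) (fun al => hess u al x).
Proof.
set D := grad u x; pose U al := hess u al x.
have ST : (S x)^T = S x := Smx_sym u x.
have UT al : (U al)^T = U al := hess_sym u_smooth al x.
have E k : dpart k (lndet2 g) x = 4 * \sum_al ((S x *m D)^T *m U al) al k.
  rewrite (dpart_lndet2 (gmx_unit u))// -/(S x) dpartmx_gmx (trace_dmetric D U ST).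
  by move: (\sum_al _) => a; ring.
transitivity (\sum_k \sum_l \sum_al \sum_be 16 * (S x k l *
    (((S x *m D)^T *m U al) al k * (U be *m (S x *m D)) l be))).
  apply: eq_bigr => k _; apply: eq_bigr => l _; rewrite !E.
  have -> : \sum_al ((S x *m D)^T *m U al) al l = \sum_be (U be *m (S x *m D)) l be.
    by apply: eq_bigr => be _; rewrite -[U be in RHS]UT -[S x *m D in RHS]trmxK -trmx_mul [RHS]mxE.
  transitivity (16 * (S x k l * ((\sum_al ((S x *m D)^T *m U al) al k) * (\sum_be (U be *m (S x *m D)) l be)))).
    have reorder (a b c : R) : a * (4 * b * (4 * c)) = 16 * (a * (b * c)) by ring.
    exact: reorder.
  rewrite mulr_suml !mulr_sumr; apply: eq_bigr => al _; rewrite !mulr_sumr.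
  by apply: eq_bigr => be _.
transitivity (\sum_al \sum_be \sum_k \sum_l 16 * (S x k l *
    (((S x *m D)^T *m U al) al k * (U be *m (S x *m D)) l be))).
  under eq_bigr do rewrite exchange_big /=.
  rewrite exchange_big /=; apply: eq_bigr => al _.
  under eq_bigr do rewrite exchange_big /=.
  by rewrite exchange_big.
rewrite /cross mulr_sumr; apply: eq_bigr => al _; rewrite mulr_sumr; apply: eq_bigr => be _.
have := sum_bilin (S x) ((S x *m D)^T *m U al) (U be *m (S x *m D)) al be.
rewrite !mulmxA => <-; rewrite mulr_sumr; apply: eq_bigr => k _.
by rewrite mulr_sumr.
Qed.

Lemma driftlap_expR c f x : Cdiff 2 f ->
  driftlap S (fun y => expR (c * f y)) x =
  expR (c * f x) * (c * driftlap S f x + c ^+ 2 * gradS S f f x).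
Proof.
move=> Cf; have df y := Cdiff_differentiable y Cf.
have dcf y : differentiable (fun z => c * f z) y.
  by exact: Cdiff_differentiable (CdiffZ c Cf).
have E1 k y : dpart k (fun z => expR (c * f z)) y = expR (c * f y) * (c * dpart k f y).
  by rewrite (dpart_comp k (dcf y) (is_derive_expR _)) dpartZ.
have E2 k l : dpart k (dpart l (fun z => expR (c * f z))) x =
    expR (c * f x) * (c * dpart k (dpart l f) x + c ^+ 2 * (dpart k f x * dpart l f x)).
  transitivity (dpart k (fun z => expR (c * f z) * (c * dpart l f z)) x).
    by congr (dpart k _ x); apply/funext => y.
  have dl := Cdiff_differentiable x (Cdiff_dpart l Cf).
  have de := Cdiff_differentiable x (Cdiff_expR (CdiffZ c Cf)).
  have dcl := Cdiff_differentiable x (CdiffZ c (Cdiff_dpart l Cf)).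
  rewrite (dpartM k de dcl) E1 (dpartZ k c dl).
  move: (expR _) (dpart k (dpart l f) x) (dpart k f x) (dpart l f x) => e a b d; ring.
rewrite /driftlap /hessS /gradS.
have -> : \sum_k x 0 k * dpart k (fun y => expR (c * f y)) x =
    expR (c * f x) * (c * \sum_k x 0 k * dpart k f x).
  rewrite !mulr_sumr; apply: eq_bigr => k _; rewrite E1.
  move: (expR _) (x 0 k) (dpart k f x) => e a b; ring.
have -> : \sum_k \sum_l S x k l * dpart k (dpart l (fun y => expR (c * f y))) x =
    expR (c * f x) * (c * (\sum_k \sum_l S x k l * dpart k (dpart l f) x)
      + c ^+ 2 * \sum_k \sum_l S x k l * (dpart k f x * dpart l f x)).
  rewrite !mulr_sumr -big_split /= mulr_sumr; apply: eq_bigr => k _.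
  rewrite !mulr_sumr -big_split /= mulr_sumr; apply: eq_bigr => l _.
  rewrite E2; move: (expR _) (S x k l) (dpart k (dpart l f) x) (dpart k f x) (dpart l f x) => e s a b d.
  ring.
have reorder (e a b d : R) : e * (c * a + c ^+ 2 * b) - 2^-1 * (e * (c * d)) =
  e * (c * (a - 2^-1 * d) + c ^+ 2 * b) by ring.
exact: reorder.
Qed.

Hypothesis u_flat : flat_normal_bundle u.

(** [lndet2] is twice [ln (det g)], so this is [(det g)^(-1/2)]. Once [crossC] equals [cross], the
    function [expR (c * lndet2)] carries the coefficient [4 c + 16 c^2] on [cross], whose nonzero
    root is [-1/4]. *)
Definition slope x : R := expR (- 4^-1 * lndet2 g x).

(** Flatness enters here: commuting the Hessians through [S] turns [crossC] into [cross]. *)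
Lemma driftlap_slope x : driftlap S slope x =
  - (normB (S x) (grad u x) (fun al => hess u al x) * slope x).
Proof.
have Cl : Cdiff 2 (lndet2 g) by apply: Cdiff_lndet2 => //; exact: gmx_unit.
rewrite /slope driftlap_expR// driftlap_lndet2_normB gradS_lndet2.
have -> : crossC (S x) (grad u x) (fun al => hess u al x) = cross (S x) (grad u x) (fun al => hess u al x).
  rewrite /crossC /cross; apply: eq_bigr => al _; apply: eq_bigr => be _.
  have := flat_hess_comm u_smooth be al x u_flat; rewrite -/(S x) => comm.
  apply: (congr1 (fun A => (A *m (S x *m grad u x)) al be)).
  by rewrite -!mulmxA; congr (_ *m _); rewrite !mulmxA.
have n4 : 4 != 0 :> R by rewrite pnatr_eq0.
by move: (expR _) (cross _ _ _) (normB _ _ _) => e a b; field.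
Qed.

End ShrinkerEquation.

Lemma dpart0_constant (R : realType) (n : nat) (f : 'rV[R]_n -> R) :
  (forall x, differentiable f x) -> (forall i x, dpart i f x = 0) -> forall x, f x = f 0.
Proof.
move=> df f0 x; have dl (s : R) := is_derive_line 0 x s df.
have [|c _] := MVT (f := fun s => f (0 + s *: x)) ltr01 (fun s _ => dl s).
  by apply: derivable_within_continuous => s _; case: (dl s).
rewrite !add0r scale1r scale0r big1 ?mul0r => [/eqP|i _]; last by rewrite f0 mulr0.
by rewrite subr_eq0 => /eqP.
Qed.

(** * Rigidity of the entire graph *)

Section EntireShrinker.
Context {R : realType} {n m : nat}.
Variable u : 'rV[R]_n -> 'rV[R]_m.
Hypothesis u_smooth : smooth u.
Hypothesis u_shrinker : self_shrinker u.
Hypothesis u_flat : flat_normal_bundle u.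

Let SgS x : Smx u x *m (1%:M + grad u x *m (grad u x)^T) = 1%:M.
Proof. by rewrite mulVmx// gmx_unit. Qed.

Lemma hess_eq0 al x : hess u al x = 0.
Proof.
have Cg N := Cdiff_gmx u_smooth N.
have Cw : Cdiff 2 (slope u).
  by apply/Cdiff_expR/CdiffZ/Cdiff_lndet2 => //; exact: gmx_unit.
have w0 y : 0 < slope u y by exact: expR_gt0.
have B0 y : 0 <= normB (Smx u y) (grad u y) (fun al => hess u al y).
  by apply: normB_ge0 => [|be|]; [exact: Smx_sym|exact: hess_sym|exact: SgS].
have Lw y : driftlap (Smx u) (slope u) y <= 0.
  by rewrite driftlap_slope// oppr_le0 mulr_ge0// ltW.
have Sgram y : exists p (Y : 'M[R]_(n, p)), Smx u y = Y *m Y^T.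
  exact: inv_metric_gram (Smx_sym u y) (SgS y).
have Spos y (v : 'rV[R]_n) : v != 0 -> 0 < \sum_k \sum_l v 0 k * v 0 l * Smx u y k l.
  exact: inv_metric_pos (Smx_sym u y) (SgS y) _.
have Str y : \tr (Smx u y) <= n%:R by exact: inv_metric_trace (Smx_sym u y) (SgS y).
have Sdiff k l : Cdiff 0 (fun y => Smx u y k l) by exact: Cdiff_Smx.
have [p pmin] := supersolution_attains_min Sgram Str Cw w0 Lw.
have wc := supersolution_min_constant Sdiff Sgram Spos Cw Lw pmin.
have : driftlap (Smx u) (slope u) x = 0.
  transitivity (driftlap (Smx u) (fun=> slope u p) x); last exact: driftlap_cst.
  by congr (driftlap _ _ x); apply/funext => y; exact: wc.
rewrite driftlap_slope// => /eqP; rewrite oppr_eq0 mulf_eq0 (gt_eqF (w0 x)) orbF => /eqP.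
move=> /normB_eq0; apply; [exact: Smx_sym|by move=> be; exact: hess_sym|exact: SgS].
Qed.

Lemma shrinker_linear x : u x = x *m grad u 0.
Proof.
have d2 i j al y : dpart i (dpart j (rowc u al)) y = 0.
  by have := hess_eq0 al y => /matrixP/(_ i j); rewrite !mxE.
have Cu N al := smooth_Cdiff u_smooth N al.
apply/rowP => al; have := self_shrinker_driftlap u_smooth al x u_shrinker.
rewrite /driftlap /hessS big1 => [|k _]; last by apply: big1 => l _; rewrite d2 mulr0.
rewrite sub0r -mulNr => /mulfI E; rewrite -[LHS]/(rowc u al x) -E ?oppr_eq0 ?invr_eq0 ?pnatr_eq0//.
rewrite mxE; apply: eq_bigr => k _; rewrite [grad u 0 k al]mxE; congr (_ * _).
apply: dpart0_constant => [y|i y]; last exact: d2.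
exact: Cdiff_differentiable (Cdiff_dpart k (Cu 1%N al)).
Qed.

End EntireShrinker.

Theorem theorem1p1 (R : realType) (n m : nat) (u : 'rV[R]_n -> 'rV[R]_m) :
  smooth u ->
  self_shrinker u ->
  flat_normal_bundle u ->
  exists A : 'M[R]_(n + m),
    range (graph_map u) = [set v : 'rV[R]_(n + m) | (v <= A)%MS].
Proof.
(* The graph consists of the vectors [x *m row_mx 1%:M (grad u 0)], the row space of this matrix;
   [<<_>>] replaces it by a square matrix with the same row space, as the type of [A] demands. *)
move=> su shu fu; exists <<row_mx 1%:M (grad u 0)>>%MS.
apply/seteqP; split=> [_ [x _ <-]|v] /=; rewrite genmxE.
  rewrite /graph_map (shrinker_linear su shu fu x) -{1}(mulmx1 x) -mul_mx_row.
  exact: submxMl.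
move=> /submxP[x ->]; exists x => //.
by rewrite /graph_map (shrinker_linear su shu fu x) mul_mx_row mulmx1.
Qed.
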